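(* Let $(\Omega,\mathrm{d})$ be a pointed metric space with base point $\mathbf{0}$, $(E,\|\cdot\|_E)$ a normed space over $\mathbb{K}$, and \[ \mathrm{Lip}_0(\Omega,E):=\Bigl\{f\colon\Omega\to E: f(\mathbf{0})=0\ \text{and}\ \|f\|^E:=\sup_{x,y\in\Omega,\,x\ne y}\frac{\|f(x)-f(y)\|_E}{\mathrm{d}(x,y)}<\infty\Bigr\}, \] with $\mathrm{Lip}_0(\Omega):=\mathrm{Lip}_0(\Omega,\mathbb{K})$, $\|\cdot\|:=\|\cdot\|^{\mathbb{K}}$, and $\Omega_{\mathrm{wd}}:=\{(x,y)\in\Omega^2:x\ne y\}$. Then the following assertions hold. (a) $(\mathrm{Lip}_0(\Omega,E),\|\cdot\|^E,\tau_{\mathrm{co}}^E)$ is a Saks space, $\tau_{\mathrm{co}}^E=\tau_{\mathcal{K}_{\Omega_{\mathrm{wd}}}}^E$ on $\|\cdot\|^E$-bounded sets, $\gamma(\|\cdot\|^E,\tau_{\mathrm{co}}^E)=\gamma(\|\cdot\|^E,\tau_{\mathcal{K}_{\Omega_{\mathrm{wd}}}}^E)$ and $\mathrm{Lip}_0(\Omega,E)=\mathrm{Lip}_0(\Omega,E)_\sigma$. (b) If $E$ is a Banach space, then $(\mathrm{Lip}_0(\Omega,E),\|\cdot\|^E,\tau_{\mathrm{co}}^E)$ is complete. (c) If $\Omega$ is hemicompact, then $(\mathrm{Lip}_0(\Omega,E),\|\cdot\|^E,\tau_{\mathrm{co}}^E)$ is C-sequential. (d) If $E=\mathbb{K}$,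 then $(\mathrm{Lip}_0(\Omega),\|\cdot\|,\tau_{\mathrm{co}})$ is semi-Montel and $\gamma(\|\cdot\|,\tau_{\mathrm{co}})=\gamma_{\mathrm{s}}(\|\cdot\|,\tau_{\mathcal{S}})$ for $\mathcal{S}\in\{\mathcal{N}_{\Omega_{\mathrm{wd}}},\mathcal{K}_{\Omega_{\mathrm{wd}}}\}$.
   Context: $\mathbb{K}\in\{\mathbb{R},\mathbb{C}\}$. A pointed metric space is a metric space with a distinguished base point $\mathbf{0}$. $\Omega$ is hemicompact if there is a sequence $(K_n)_{n\in\mathbb{N}}$ of compact subsets such that every compact subset of $\Omega$ is contained in some $K_N$. Suprema of non-negative quantities over the empty set are $0$. Saks spaces. Let $(X,\|\cdot\|)$ be a normed space and $\tau$ a locally convex Hausdorff topology on $X$ coarser than the norm topology $\tau_{\|\cdot\|}$. The mixed topology $\gamma=\gamma(\|\cdot\|,\tau)$ is the finest linear topology on $X$ that coincides with $\tau$ on $\|\cdot\|$-bounded sets and lies between $\tau$ and $\tau_{\|\cdot\|}$; it is locally convex Hausdorff. $(X,\|\cdot\|,\tau)$ is a Saks space if there is a directed system $\Gamma_\tau$ of continuous seminorms generating $\tau$ with $\|x\|=\sup_{q\in\Gamma_\tau}q(x)$ for all $x$. The submixed topology $\gamma_{\mathrm{s}}(\|\cdot\|,\tau)$ is generated by the seminorms $x\mapsto\sup_{n\in\mathbb{N}}q_n(x)a_n$ with $(q_n)_{n\in\mathbb{N}}\subset\Gamma_\tau$ and $(a_n)_{n\in\mathbb{N}}$ a real non-negative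 null-sequence (independent of the choice of such $\Gamma_\tau$). A Saks space is complete if $(X,\gamma)$ is complete; semi-Montel if $(X,\gamma)$ is a semi-Montel space (bounded sets are relatively compact); C-sequential if every convex sequentially open subset of $(X,\gamma)$ is open. Topologies. $\tau_{\mathrm{co}}^E$ is the (relative) topology of uniform convergence on compact subsets of $\Omega$; $\tau_{\mathrm{co}}:=\tau_{\mathrm{co}}^{\mathbb{K}}$. $\mathcal{N}_{\Omega_{\mathrm{wd}}}$ and $\mathcal{K}_{\Omega_{\mathrm{wd}}}$ are the families of finite resp. compact subsets of $\Omega_{\mathrm{wd}}\subset\Omega^2$. For $\mathcal{S}$ one of these families, $\tau_{\mathcal{S}}^E$ on $\mathrm{Lip}_0(\Omega,E)$ is generated by the seminorms $q_S^E(f):=\sup_{(x,y)\in S}\frac{\|f(x)-f(y)\|_E}{\mathrm{d}(x,y)}$, $S\in\mathcal{S}$; $\tau_{\mathcal{S}}:=\tau_{\mathcal{S}}^{\mathbb{K}}$. Weak version. $\mathrm{Lip}_0(\Omega,E)_\sigma:=\{f\colon\Omega\to E:e^*\circ f\in\mathrm{Lip}_0(\Omega)\text{ for all }e^*\in E^*\}$. *)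

(* Defs.v *)
From HB Require Import structures.
From mathcomp Require Import all_boot all_order all_algebra.
From mathcomp Require Import finmap complex.
From mathcomp Require Import all_classical all_reals all_analysis.

Set Implicit Arguments.
Unset Strict Implicit.
Unset Printing Implicit Defensive.

Import Order.TTheory GRing.Theory Num.Theory.
Import numFieldNormedType.Exports.

Local Open Scope classical_set_scope.
Local Open Scope ring_scope.

Variant scalar_kind := RealScalars | ComplexScalars.

Definition scalars (R : realType) (k : scalar_kind) : numFieldType :=
  match k with
  | RealScalars => R
  | ComplexScalars => R[i]
  end.

Definition real_part (R : realType) (k : scalar_kind) : scalars R k -> R :=
  match k with
  | RealScalars => fun a => a
  | ComplexScalars => fun a => complex.Re a
  end.

(* The library norm of a [normedModType K] takes its values in [K], on the
   non-negative real axis when [K] is [R[i]]; [rnorm] is its value in [R]. *)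
Definition rnorm (R : realType) (k : scalar_kind)
  (V : normedModType (scalars R k)) (v : V) : R := real_part `|v|.

Definition rabs (R : realType) (k : scalar_kind) (a : scalars R k) : R :=
  real_part `|a|.

(* Several topologies live on the same space: as for [sup_topology], a topology
   on [X] is an element of [Topological X], and [top t] is [X] equipped with
   [t]. *)
Definition top (X : Type) (t : Topological X) : topologicalType :=
  Topological.Pack t.

Definition opens (X : Type) (t : Topological X) : set (set X) := @open (top t).

Definition coarser (X : Type) (t1 t2 : Topological X) := opens t1 `<=` opens t2.

Definition coincide_on (X : Type) (B : set X) (t1 t2 : Topological X) :=
  [set B `&` U | U in opens t1] = [set B `&` U | U in opens t2].

Definition sequentially_open (X : Type) (t : Topological X) (U : set X) :=
  forall (x : top t) (u : nat -> top t),
    U x -> u @ \oo --> x -> \forall m \near \oo, U (u m).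

Section SeminormTopology.
Context (R : realType) (k : scalar_kind) (X : lmodType (scalars R k)).

Definition seminorm (p : X -> R) :=
  (forall x y, p (x + y) <= p x + p y) /\
  (forall (a : scalars R k) x, p (a *: x) = rabs a * p x).

Definition is_norm (p : X -> R) := seminorm p /\ forall x, p x = 0 -> x = 0.

Definition seminorm_topology (G : set (X -> R)) : Type := X.

Definition seminorm_open (G : set (X -> R)) : set (set X) :=
  [set U | forall x, U x -> exists2 F : set (X -> R), finite_set F /\ F `<=` G &
    exists2 e : R, 0 < e &
      [set y | forall q, F q -> q (y - x) < e] `<=` U].

Variable G : set (X -> R).

Let openT : seminorm_open G setT.
Proof.
move=> x _; exists set0; first by split => //; exact: finite_set0.
by exists 1.
Qed.

Let openI : setI_closed (seminorm_open G).
Proof.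
move=> U V oU oV x [/oU[F [fF FG] [e e0 FU]] /oV[F' [fF' F'G] [e' e'0 FV]]].
exists (F `|` F'); first split.
- by rewrite finite_setU.
- by move=> q [/FG|/F'G].
exists (Num.min e e'); first by rewrite lt_min e0.
move=> y xy; split.
- by apply: FU => q Fq; have := xy q (or_introl Fq); rewrite lt_min => /andP[].
- by apply: FV => q Fq; have := xy q (or_intror Fq); rewrite lt_min => /andP[].
Qed.

Let open_bigU (I : Type) (f : I -> set X) :
  (forall i, seminorm_open G (f i)) -> seminorm_open G (\bigcup_i f i).
Proof.
move=> of_ x [i _ /of_[F FG [e e0 FU]]].
by exists F => //; exists e => // y /FU ?; exists i.
Qed.

HB.instance Definition _ := Choice.on (seminorm_topology G).
HB.instance Definition _ :=
  isOpenTopological.Build (seminorm_topology G) openT openI open_bigU.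

End SeminormTopology.

Section SaksSpaces.
Context (R : realType) (k : scalar_kind) (X : lmodType (scalars R k)).
Local Notation K := (scalars R k).
Implicit Types (n : X -> R) (t tau : Topological X) (G : set (X -> R)).

Definition generated_by G : Topological X :=
  Topological.on (seminorm_topology G).

Definition norm_topology n : Topological X := generated_by [set n].

Definition norm_bounded n (B : set X) := exists M : R, forall x, B x -> n x <= M.

Definition linear_topology t :=
  continuous (fun z : top t * top t => (z.1 + z.2 : X) : top t) /\
  continuous (fun z : K^o * top t => (z.1 *: (z.2 : X)) : top t).

Definition locally_convex_hausdorff t :=
  [/\ linear_topology t,
      exists2 B : set_system (top t),
        (forall b, b \in B -> convex_set (b : set (convex_lmodType X)))
        & basis B
    & hausdorff_space (top t)].

Definition mixed_candidate n tau t :=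
  [/\ linear_topology t,
      forall B, norm_bounded n B -> coincide_on B t tau,
      coarser tau t
    & coarser t (norm_topology n)].

(* The open sets of all candidates form a subbase of the mixed topology, which
   is thus their supremum; by [mixed_topologyP] it is itself a candidate, hence
   the finest one. ([sup_topology] cannot be used here: its index type would be
   too large.) *)
Definition mixed_subbase n tau : set (set X) :=
  [set U | exists2 t, mixed_candidate n tau t & opens t U].

Definition mixed_space n tau : Type := X.

HB.instance Definition _ n tau := Choice.on (mixed_space n tau).
HB.instance Definition _ n tau :=
  isSubBaseTopological.Build (mixed_space n tau) (mixed_subbase n tau) id.

Definition mixed_topology n tau : Topological X :=
  Topological.on (mixed_space n tau).

Definition directed G :=
  G !=set0 /\
  forall p q, G p -> G q ->
    exists r, [/\ G r, forall x, p x <= r x & forall x, q x <= r x].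

Definition saks_system n tau G :=
  [/\ directed G,
      forall q, G q -> seminorm q /\ continuous (q : top tau -> R^o),
      opens tau = opens (generated_by G)
    & forall x, (n x)%:E = ereal_sup [set (q x)%:E | q in G]].

Definition saks_space n tau :=
  [/\ is_norm n,
      locally_convex_hausdorff tau,
      coarser tau (norm_topology n)
    & exists G, saks_system n tau G].

(* The submixed topology attached to a system [G] as in [saks_system n tau G];
   the real suprema are then finite, since [q x <= n x] for [q] in [G]. *)
Definition submixed_topology G : Topological X :=
  generated_by
    [set p | exists q : nat -> X -> R, exists a : nat -> R,
      [/\ forall m, G (q m), forall m, 0 <= a m, a @ \oo --> (0 : R^o)
        & p = fun x => sup [set q m x * a m | m in [set: nat]]]].

Definition cauchy_filter t (F : set_system X) :=
  forall U, nbhs (0 : top t) U ->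
    exists2 A, F A & forall x y, A x -> A y -> U (x - y).

Definition complete_topology t :=
  forall F : set_system (top t), ProperFilter F -> cauchy_filter t F ->
    exists x : top t, F --> x.

Definition von_neumann_bounded t (B : set X) :=
  forall U, nbhs (0 : top t) U ->
    exists2 r : R, 0 < r &
      forall a : K, r <= rabs a -> B `<=` [set a *: u | u in U].

Definition saks_complete n tau := complete_topology (mixed_topology n tau).

Definition saks_semi_montel n tau :=
  forall B : set (top (mixed_topology n tau)),
    von_neumann_bounded (mixed_topology n tau) B -> precompact B.

Definition saks_C_sequential n tau :=
  forall U : set X, convex_set (U : set (convex_lmodType X)) ->
    sequentially_open (mixed_topology n tau) U ->
    opens (mixed_topology n tau) U.

End SaksSpaces.

Section MixedTopology.
Context (R : realType) (k : scalar_kind) (X : lmodType (scalars R k)).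
Variables (n : X -> R) (tau : Topological X).
Local Notation mix := (mixed_topology n tau).

Let coarser_nbhs (t t' : Topological X) : coarser t t' ->
  forall (x : X) U, nbhs (x : top t) U -> nbhs (x : top t') U.
Proof.
move=> tt' x U; rewrite !nbhsE => -[V [oV Vx] VU].
by exists V => //; split => //; exact: tt'.
Qed.

Let nbhs_coarser (t t' : Topological X) :
  (forall (x : X) U, nbhs (x : top t) U -> nbhs (x : top t') U) ->
  coarser t t'.
Proof.
move=> tt' U oU; rewrite /opens openE => x Ux; apply: tt'.
exact: (@open_nbhs_nbhs (top t) x U).
Qed.

Let mix_cvg (F : set_system X) (x : X) : Filter F ->
  F --> (x : top mix) <->
  forall t, mixed_candidate n tau t -> F --> (x : top t).
Proof.
move=> FF; split => [Fx t ct|Fx].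
  move=> A; rewrite (@nbhsE (top t)) => -[B [oB Bx] BA].
  apply: Fx; exists B; split=> //; exists [set B]; last first.
    by rewrite predeqE => ?; split=> [[_ ->]|] //; exists B.
  move=> _ ->; exists [fset B]%fset.
    by move=> ?; rewrite inE inE => /eqP ->; exists t.
  by rewrite predeqE=> ?; split=> [|??]; [apply|]; rewrite /= inE // => /eqP ->.
move=> A; rewrite (@nbhsE (top mix)) => -[_ [[B sB <-] [C BC Cx]] sBA].
rewrite nbhs_filterE; apply: filterS sBA _; apply: (@filterS _ _ _ C).
  by move=> ? ?; exists C.
have /sB[D sD DC] := BC; rewrite -DC; apply: filter_bigI => V DV.
have /sD := DV; rewrite inE => -[t ct oV]; apply: (Fx t ct).
apply: (@open_nbhs_nbhs (top t)); split => //.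
by move: Cx; rewrite -DC => /(_ _ DV).
Qed.

Let candidate_coarser (t : Topological X) :
  mixed_candidate n tau t -> coarser t mix.
Proof.
move=> ct; apply: nbhs_coarser => x U.
exact: (mix_cvg x (nbhs_filter (x : top mix))).1 (fun _ => id) t ct U.
Qed.

Lemma mixed_topologyP :
  linear_topology tau -> coarser tau (norm_topology n) ->
  mixed_candidate n tau mix /\
  forall t, mixed_candidate n tau t -> coarser t mix.
Proof.
move=> ltau taun; split; last exact: candidate_coarser.
have ctau : mixed_candidate n tau tau by split.
split.
- split => z.
  + apply/mix_cvg => t ct U; have [[ladd _] _ _ _] := ct.
    move=> /(ladd z)[[A B] [/= zA zB] ABU].
    by exists (A, B) => //; split; apply: (coarser_nbhs (candidate_coarser ct)).
  + apply/mix_cvg => t ct U; have [[_ lscale] _ _ _] := ct.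
    move=> /(lscale z)[[A B] [/= zA zB] ABU].
    exists (A, B) => //; split => //.
    by apply: (coarser_nbhs (candidate_coarser ct)).
- move=> B bB; apply/seteqP; split=> _ [U oU <-]; last first.
    by exists U => //; exact: candidate_coarser oU.
  exists (\bigcup_(V in [set V | opens tau V /\ B `&` V `<=` U]) V).
    by apply: (@bigcup_open (top tau)) => V [].
  apply/seteqP; split=> x [Bx]; first by case=> V [_ BV] Vx; split=> //; exact: BV.
  move=> Ux; split => //.
  have WF : Filter (within B (nbhs (x : top tau))).
    by apply: within_filter; exact: nbhs_filter.
  have : within B (nbhs (x : top tau)) U.
    have /mix_cvg cv := WF; apply: ((cv x).2 _ U); last first.
      exact: (@open_nbhs_nbhs (top mix) x U).
    move=> t ct V; rewrite (@nbhsE (top t)) => -[W [oW Wx] WV].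
    have [_ /(_ _ bB) co _ _] := ct.
    have : [set B `&` U | U in opens tau] (B `&` W) by rewrite -co; exists W.
    case=> W' oW' BW.
    have W'x : W' x by have : (B `&` W) x by []; rewrite -BW => -[].
    rewrite /within/= (@nbhsE (top tau)); exists W' => //= y W'y By; apply: WV.
    by have : (B `&` W') y by []; rewrite BW => -[].
  rewrite /within/= (@nbhsE (top tau)) => -[V [oV Vx] VU].
  by exists V => //; split => // y [By /VU]; apply.
- exact: candidate_coarser.
- apply: nbhs_coarser => x U.
  have /mix_cvg cv := nbhs_filter (x : top (norm_topology n)).
  apply: ((cv x).2 _ U) => t ct V.
  by apply: coarser_nbhs; case: ct.
Qed.

End MixedTopology.

Section LipschitzFunctions.
Context (R : realType) (k : scalar_kind) (Om : metricType R) (o : Om).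
Variable E : normedModType (scalars R k).
Implicit Types (f : Om -> E) (S : set (Om * Om)).

(* The set written Omega_{wd}: pairs without the diagonal. *)
Definition off_diagonal : set (Om * Om) := [set z | z.1 <> z.2].

Definition slopes f S : set R :=
  [set rnorm (f z.1 - f z.2) / mdist z.1 z.2 | z in S].

Definition lip0 : set (Om -> E) :=
  [set f | f o = 0 /\ has_ubound (slopes f off_diagonal)].

Definition lip0_pred : {pred Om -> E} := mem lip0.

Record Lip0 := MkLip0 { lip0_fun :> Om -> E; _ : lip0_fun \in lip0_pred }.

HB.instance Definition _ := [isSub for lip0_fun].
HB.instance Definition _ := [Choice of Lip0 by <:].

Let rnormD (v w : E) : rnorm (v + w) <= rnorm v + rnorm w.
Proof.
have := ler_normD v w; rewrite /rnorm.
move: `|v| `|w| `|v + w|; case: k => //= -[a ?] [b ?] [c ?].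
by rewrite lecE/= => /andP[].
Qed.

Let rnormZ (a : scalars R k) (v : E) : rnorm (a *: v) = rabs a * rnorm v.
Proof.
rewrite /rnorm /rabs normrZ.
have := normr_ge0 a; have := normr_ge0 v.
move: `|v| `|a|; case: k => //= -[x y] [z t].
rewrite !lecE/= => /andP[/eqP -> _] /andP[/eqP -> _].
by rewrite mulr0 subr0.
Qed.

Let rabs_ge0 (a : scalars R k) : 0 <= rabs a.
Proof.
rewrite /rabs; have := normr_ge0 a; move: `|a|; case: k => //= -[x y].
by rewrite lecE/= => /andP[].
Qed.

Let lip0_closed : subsemimod_closed lip0_pred.
Proof.
split; first split.
- rewrite inE; split => //; exists 0 => _ [z zwd <-].
  rewrite /= subrr -(scale0r 0) rnormZ.
  suff -> : rabs (0 : scalars R k) = 0 by rewrite !mul0r.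
  by rewrite /rabs normr0; case: (k).
- move=> f g; rewrite !inE => -[f0 [M fM]] [g0 [N gN]]; split.
    by rewrite /= fctE f0 g0 addr0.
  exists (M + N) => _ [z zwd <-].
  have zM : rnorm (f z.1 - f z.2) / mdist z.1 z.2 <= M by apply: fM; exists z.
  have zN : rnorm (g z.1 - g z.2) / mdist z.1 z.2 <= N by apply: gN; exists z.
  apply: (le_trans _ (lerD zM zN)).
  rewrite -mulrDl ler_wpM2r ?invr_ge0 ?mdist_ge0//.
  by rewrite opprD addrACA rnormD.
- move=> a f; rewrite !inE => -[f0 [M fM]]; split.
    by rewrite /= fctE f0 scaler0.
  exists (rabs a * M) => _ [z zwd <-].
  have zM : rnorm (f z.1 - f z.2) / mdist z.1 z.2 <= M by apply: fM; exists z.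
  by rewrite -scalerBr rnormZ -mulrA ler_wpM2l.
Qed.

HB.instance Definition _ :=
  GRing.SubChoice_isSubLmodule.Build (scalars R k) (Om -> E) lip0_pred Lip0
    lip0_closed.

(* [sup set0 = 0], and the suprema below are finite on [Lip0]. *)
Definition slope_seminorm S (f : Lip0) : R := sup (slopes f S).

Definition lip_norm (f : Lip0) : R := slope_seminorm off_diagonal f.

Definition finite_pairs : set (set (Om * Om)) :=
  [set S | finite_set S /\ S `<=` off_diagonal].

Definition compact_pairs : set (set (Om * Om)) :=
  [set S | compact S /\ S `<=` off_diagonal].

Definition tau_fam (SS : set (set (Om * Om))) : Topological Lip0 :=
  generated_by [set slope_seminorm S | S in SS].

Definition tau_co : Topological Lip0 :=
  Topological.on
    (initial_topology (fun f : Lip0 => lip0_fun f : {family compact, Om -> E})).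

End LipschitzFunctions.

Arguments lip0 {R k Om} o E _.
Arguments lip_norm {R k Om} o E f : rename.
Arguments finite_pairs {R} Om.
Arguments compact_pairs {R} Om.

Definition lip0_weak (R : realType) (k : scalar_kind) (Om : metricType R)
    (o : Om) (E : normedModType (scalars R k)) : set (Om -> E) :=
  [set f : Om -> E | forall e' : {linear E -> (scalars R k)^o}, continuous e' ->
    lip0 o (scalars R k)^o (e' \o f)].

Arguments lip0_weak {R k Om} o E _.

Definition hemicompact (T : topologicalType) :=
  exists2 K_ : nat -> set T, forall m, compact (K_ m) &
    forall C : set T, compact C -> exists m, C `<=` K_ m.

Definition banach (R : realType) (k : scalar_kind)
    (E : normedModType (scalars R k)) :=
  forall F : set_system E, ProperFilter F -> cauchy F -> cvg F.

(* Main.v *)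
From HB Require Import structures.
Require Import Defs.
From mathcomp Require Import all_boot all_order all_algebra.
From mathcomp Require Import complex.
From mathcomp Require Import all_classical all_reals all_analysis.
From mathcomp Require Import ring lra.

(* Everything is reduced to seminorms. For a topology [tau] given by continuous
   seminorms, the mixed topology of [tau] and the norm [n] is given by the
   seminorms whose restrictions to norm-bounded sets are [tau]-continuous at 0:
   a neighbourhood of 0 contains sums of pieces [{p_i < 1, n < i + 1}], hence the
   unit ball of the infimal convolution of the seminorms [max (p_i, n / (i + 1))].
   Decompositions along this infimal convolution also show that mixed
   neighbourhoods contain [tau]-closed ones (completeness) and that convex sets
   are open as soon as their traces on balls are (C-sequentiality, as balls are
   metrizable when [Om] is hemicompact).

   Lipschitz functions bounded in norm are equi-Lipschitz, so on bounded sets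
   compact convergence is convergence of slopes towards the base point on finite
   sets, and scalar balls are compact. A Banach-Dieudonne construction on the
   compact balls then gives the submixed description.

   Weakly Lipschitz maps are Lipschitz since weakly bounded sets are bounded;
   this uses a real Hahn-Banach theorem and Sokal's gliding hump, a real
   functional [f] being dominated by the scalar one [x |-> f x - i f (i x)]. *)

Set Implicit Arguments.
Unset Strict Implicit.
Unset Printing Implicit Defensive.

Import Order.TTheory GRing.Theory Num.Theory.
Import numFieldNormedType.Exports.

Local Open Scope classical_set_scope.
Local Open Scope ring_scope.

(** The mixed topology is given only as a supremum of linear topologies, so its local convexity has
    to be proved: continuity of addition yields successively halved neighbourhoods, and the
    seminorms are built from these. A second obstacle is that mixed neighbourhoods and mixed Cauchy
    filters reach beyond every ball, whereas what is known about [tau] concerns one ball at a time.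
    Two kinds of seminorms bridge the gap. The infimal convolutions fill neighbourhoods from inside;
    on {n <= M} the single index with M < e (i + 1) keeps them below e where p_i < e. The weighted
    suprema sup_m a_m q_m, with q_m <= n and a null sequence a, detect unboundedness from outside:
    if q_m exceeds (m + 1)^2 at suitable points, the weights 1 / (m + 1) still leave values above m
    + 1. This one device shows that mixed-bounded sets are norm-bounded and that the pointwise limit
    of a mixed Cauchy filter is Lipschitz; its seminorms are also those that generate the submixed
    topology. *)

Section Scalars.
Context (R : realType) (k : scalar_kind).
Local Notation K := (scalars R k).

(** A section of [real_part] onto the real axis of [K]. It is injective and respects order and
    absolute value, so relations between [K]-valued norms pass to [R] without a case analysis on
    [k]. *)
Definition of_real : R -> K :=
  match k with
  | RealScalars => fun r => r
  | ComplexScalars => fun r => r%:C%C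
  end.

Lemma of_realD r s : of_real (r + s) = of_real r + of_real s.
Proof. by rewrite /of_real; case: k => //=; exact: rmorphD. Qed.

Lemma of_realM r s : of_real (r * s) = of_real r * of_real s.
Proof. by rewrite /of_real; case: k => //=; exact: rmorphM. Qed.

Lemma of_real1 : of_real 1 = 1.
Proof. by rewrite /of_real; case: k. Qed.

Lemma of_real0 : of_real 0 = 0.
Proof. by rewrite /of_real; case: k. Qed.

Lemma of_realN r : of_real (- r) = - of_real r.
Proof. by rewrite /of_real; case: k => //=; exact: rmorphN. Qed.

Lemma ler_of_real r s : (of_real r <= of_real s) = (r <= s).
Proof. by rewrite /of_real; case: k => //=; rewrite lecR. Qed.

Lemma ltr_of_real r s : (of_real r < of_real s) = (r < s).
Proof. by rewrite /of_real; case: k => //=; rewrite ltcR. Qed.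

Lemma real_of_real r : real_part (of_real r) = r.
Proof. by rewrite /of_real /real_part; case: k. Qed.

Lemma ge0_of_real (a : K) : 0 <= a -> a = of_real (real_part a).
Proof.
rewrite /of_real /real_part; case: (k) a => //= -[a b].
by rewrite lecE /= => /andP[/eqP -> _].
Qed.

Lemma normr_of_real r : `|of_real r| = of_real `|r|.
Proof.
rewrite /of_real; case: k => //=.
by rewrite normc_def /= expr0n addr0 sqrtr_sqr.
Qed.

Lemma of_real_inj : injective of_real.
Proof. by move=> r s /(congr1 (@real_part R k)); rewrite !real_of_real. Qed.

Lemma norm_rabs (a : K) : `|a| = of_real (rabs a).
Proof. exact/ge0_of_real/normr_ge0. Qed.

Lemma rabs_ge0 (a : K) : 0 <= rabs a.
Proof. by rewrite -ler_of_real of_real0 -norm_rabs. Qed.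

Lemma rabs0 : rabs (0 : K) = 0.
Proof. by apply: of_real_inj; rewrite -norm_rabs normr0 of_real0. Qed.

Lemma rabsM (a b : K) : rabs (a * b) = rabs a * rabs b.
Proof. by apply: of_real_inj; rewrite of_realM -!norm_rabs normrM. Qed.

Lemma rabs_of_real r : rabs (of_real r) = `|r|.
Proof. by apply: of_real_inj; rewrite -!norm_rabs normr_of_real. Qed.

Lemma rabs1 : rabs (1 : K) = 1.
Proof. by rewrite -of_real1 rabs_of_real normr1. Qed.

Lemma rabsN (a : K) : rabs (- a) = rabs a.
Proof. by rewrite /rabs normrN. Qed.

Lemma rabs_eq0 (a : K) : (rabs a == 0) = (a == 0).
Proof.
by rewrite -[RHS]normr_eq0 norm_rabs -of_real0 (inj_eq of_real_inj).
Qed.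

Lemma rabsV (a : K) : rabs a^-1 = (rabs a)^-1.
Proof.
have [->|a0] := eqVneq a 0; first by rewrite invr0 rabs0 invr0.
apply: (mulfI (x := rabs a)); first by rewrite rabs_eq0.
by rewrite -rabsM divff // rabs1 divff // rabs_eq0.
Qed.

Section Norm.
Variable V : normedModType K.
Implicit Types v w : V.

Lemma norm_rnorm v : `|v| = of_real (rnorm v).
Proof. exact/ge0_of_real/normr_ge0. Qed.

Lemma rnorm_ge0 v : 0 <= rnorm v.
Proof. by rewrite -ler_of_real of_real0 -norm_rnorm. Qed.

Lemma ler_rnormD v w : rnorm (v + w) <= rnorm v + rnorm w.
Proof. by rewrite -ler_of_real of_realD -!norm_rnorm ler_normD. Qed.

Lemma rnormZ a v : rnorm (a *: v) = rabs a * rnorm v.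
Proof.
by apply: of_real_inj; rewrite of_realM -!norm_rnorm -norm_rabs normrZ.
Qed.

Lemma rnormN v : rnorm (- v) = rnorm v.
Proof. by rewrite /rnorm normrN. Qed.

Lemma rnorm0 : rnorm (0 : V) = 0.
Proof. by rewrite -(scale0r 0) rnormZ rabs0 mul0r. Qed.

Lemma rnorm_eq0 v : rnorm v = 0 -> v = 0.
Proof. by move=> v0; apply: normr0_eq0; rewrite norm_rnorm v0 of_real0. Qed.

Lemma rnormB v w : rnorm (v - w) = rnorm (w - v).
Proof. by rewrite -rnormN opprB. Qed.

Lemma ler_rnormB u v w : rnorm (u - w) <= rnorm (u - v) + rnorm (v - w).
Proof.
by apply: le_trans (ler_rnormD _ _); rewrite addrA subrK.
Qed.

Lemma nbhs_rnorm v (U : set V) :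
  nbhs v U <-> exists2 e : R, 0 < e & [set w | rnorm (w - v) < e] `<=` U.
Proof.
split => [/nbhs_ballP[e /= e0 eU]|[e e0 eU]].
  move: (e0); rewrite (ge0_of_real (ltW e0)); set r := real_part e => r0.
  exists r; first by rewrite -ltr_of_real of_real0.
  move=> w wv; apply: eU; rewrite -ball_normE /= (ge0_of_real (ltW e0)).
  by rewrite distrC norm_rnorm ltr_of_real.
apply/nbhs_ballP; exists (of_real e); first by rewrite /= -of_real0 ltr_of_real.
move=> w; rewrite -ball_normE /= distrC norm_rnorm ltr_of_real; exact: eU.
Qed.

Lemma near_rnorm v (e : R) : 0 < e -> nbhs v [set w | rnorm (w - v) < e].
Proof. by move=> e0; apply/nbhs_rnorm; exists e. Qed.

End Norm.

Lemma rnorm_scalars (a : K) : rnorm (a : K^o) = rabs a.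
Proof. by []. Qed.

End Scalars.

(** * Topologies generated by seminorms *)

Notation nbhs_in t x := (nbhs (x : top t)).

Section Topologies.
Context (X : Type).
Implicit Types t : Topological X.

Lemma nbhs_opens t (x : X) (U : set X) :
  nbhs_in t x U <-> exists V : set X, [/\ opens t V, V x & V `<=` U].
Proof.
rewrite (@nbhsE (top t)); split => [[V [oV Vx] VU]|[V [oV Vx VU]]].
  by exists V.
by exists V => //; split.
Qed.

Lemma opensP t (U : set X) :
  opens t U <-> forall x, U x -> nbhs_in t x U.
Proof.
split => [oU x Ux|nU]; first by apply/nbhs_opens; exists U; split.
by rewrite /opens openE => x /nU.
Qed.

Lemma coarserP t t' :
  coarser t t' <-> forall (x : X) U, nbhs_in t x U -> nbhs_in t' x U.
Proof.
split => [tt' x U /nbhs_opens[V [oV Vx VU]]|tt' U /opensP oU].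
  by apply/nbhs_opens; exists V; split => //; exact: (tt' V oV).
by apply/opensP => x /oU; exact: tt'.
Qed.

Lemma opens_eqP t t' : opens t = opens t' <-> coarser t t' /\ coarser t' t.
Proof.
split=> [tt'|[tt' t't]]; first by split; rewrite /coarser tt'.
by apply/seteqP.
Qed.

Lemma coincide_onP (B : set X) t t' :
  coincide_on B t t' <->
  (forall x U, B x -> nbhs_in t x U ->
     exists2 V, nbhs_in t' x V & B `&` V `<=` U) /\
  (forall x U, B x -> nbhs_in t' x U ->
     exists2 V, nbhs_in t x V & B `&` V `<=` U).
Proof.
have half s s' : [set B `&` U | U in opens s] `<=` [set B `&` U | U in opens s'] <->
    forall x U, B x -> nbhs_in s x U ->
      exists2 V, nbhs_in s' x V & B `&` V `<=` U.
  split => [ss' x U Bx /nbhs_opens[V [oV Vx VU]]|ss' _ [U oU <-]].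
    have [W oW BW] := ss' _ (ex_intro2 _ _ V oV erefl).
    exists W => [|y]; last by rewrite BW => -[_ /VU].
    apply/nbhs_opens; exists W; split => //.
    by have : (B `&` V) x by []; rewrite -BW => -[].
  (* [B] need not be open, so the witness is the largest [s']-open set whose trace on [B] lies in
     [U]. *)
  exists (\bigcup_(V in [set V | opens s' V /\ B `&` V `<=` U]) V).
    by apply: (@bigcup_open (top s')) => V [].
  apply/seteqP; split=> x [Bx]; first by case=> V [_ BV] Vx; split=> //; exact: BV.
  move=> Ux; split => //.
  have [|V /nbhs_opens[W [oW Wx WV]] BVU] := ss' x U Bx.
    by move/opensP : oU; exact.
  by exists W => //; split => // y [By /WV]; apply: (fun a b => BVU y (conj a b)).
rewrite /coincide_on; split=> [e|[h1 h2]].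
  by split; apply/half; rewrite e.
by apply/seteqP; split; apply/half.
Qed.

Lemma coincide_on_trans B t1 t2 t3 :
  coincide_on B t1 t2 -> coincide_on B t2 t3 -> coincide_on B t1 t3.
Proof. by rewrite /coincide_on => -> ->. Qed.

Lemma compact_coarser t t' (A : set X) :
  coarser t t' -> compact (A : set (top t')) -> compact (A : set (top t)).
Proof.
move=> /coarserP tt' cA F FF FA; have [x [Ax clx]] := cA F FF FA.
by exists x; split => // P Q FP /tt'; exact: clx.
Qed.

Lemma compact_coincide (B A : set X) t t' : coincide_on B t t' -> A `<=` B ->
  compact (A : set (top t)) -> compact (A : set (top t')).
Proof.
move=> /coincide_onP[_ t't] AB cA F FF FA; have [x [Ax clx]] := cA F FF FA.
exists x; split => // P Q FP nQ.
have [V nV VQ] := t't x Q (AB _ Ax) nQ.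
have [y [[Py Ay] Vy]] := clx _ _ (filterI FP FA) nV.
by exists y; split => //; apply: VQ; split => //; exact: AB.
Qed.

End Topologies.

Section Seminorms.
Context (R : realType) (k : scalar_kind) (X : lmodType (scalars R k)).
Local Notation K := (scalars R k).
Implicit Types (p q : X -> R) (x y : X).

Lemma seminormD p x y : seminorm p -> p (x + y) <= p x + p y.
Proof. by case. Qed.

Lemma seminormZ p a x : seminorm p -> p (a *: x) = rabs a * p x.
Proof. by case. Qed.

Lemma seminorm0 p : seminorm p -> p 0 = 0.
Proof. by move=> pn; rewrite -(scale0r 0) seminormZ // rabs0 mul0r. Qed.

Lemma seminormN p x : seminorm p -> p (- x) = p x.
Proof. by move=> pn; rewrite -scaleN1r seminormZ // rabsN rabs1 mul1r. Qed.

Lemma seminormBC p x y : seminorm p -> p (x - y) = p (y - x).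
Proof. by move=> pn; rewrite -seminormN // opprB. Qed.

Lemma seminorm_ge0 p x : seminorm p -> 0 <= p x.
Proof.
move=> pn; have := seminormD x (- x) pn.
by rewrite subrr seminorm0 // seminormN // -mulr2n pmulrn_lge0.
Qed.

Lemma seminormB p x y z : seminorm p -> p (x - z) <= p (x - y) + p (y - z).
Proof.
by move=> pn; apply: le_trans (seminormD _ _ pn); rewrite addrA subrK.
Qed.

Lemma seminorm_le p x y : seminorm p -> p x <= p (x - y) + p y.
Proof. by move=> pn; apply: le_trans (seminormD _ _ pn); rewrite subrK. Qed.

Lemma seminorm_sum p (I : Type) (r : seq I) (P : pred I) (F : I -> X) :
  seminorm p -> p (\sum_(i <- r | P i) F i) <= \sum_(i <- r | P i) p (F i).
Proof.
move=> pn; elim/big_rec2 : _ => [|i y x _ xy]; first by rewrite seminorm0.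
by apply: le_trans (seminormD _ _ pn) _; rewrite lerD2l.
Qed.

(** The inequality for [a^-1] gives the reverse one for [a]. Suprema and infima of seminorms thus
    need only one-sided estimates. *)
Lemma seminormP p : (forall x, 0 <= p x) ->
  (forall x y, p (x + y) <= p x + p y) ->
  (forall (a : K) x, p (a *: x) <= rabs a * p x) -> seminorm p.
Proof.
move=> p0 pD pZ; split => // a x; apply/eqP; rewrite eq_le pZ /=.
have [->|a0] := eqVneq a 0; first by rewrite rabs0 mul0r.
have /(ler_wpM2l (rabs_ge0 a)) := pZ a^-1 (a *: x).
rewrite scalerK // rabsV mulrA divff ?mul1r //.
by rewrite rabs_eq0.
Qed.

Lemma seminorm_cst0 : seminorm (fun _ : X => 0 : R).
Proof. by split => [x y|a x]; rewrite ?addr0 ?mulr0. Qed.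

Lemma seminorm_max p q : seminorm p -> seminorm q ->
  seminorm (fun x => Num.max (p x) (q x)).
Proof.
move=> pn qn; apply: seminormP => [x|x y|a x].
- by rewrite le_max seminorm_ge0.
- rewrite ge_max; apply/andP; split.
    by apply: le_trans (seminormD _ _ pn) (lerD _ _); rewrite le_max lexx.
  by apply: le_trans (seminormD _ _ qn) (lerD _ _); rewrite le_max lexx orbT.
- rewrite !seminormZ // ge_max !ler_wpM2l ?rabs_ge0 // le_max lexx //.
  by rewrite orbT.
Qed.

Lemma seminorm_scale p (c : R) : 0 <= c -> seminorm p ->
  seminorm (fun x => c * p x).
Proof.
move=> c0 pn; split => [x y|a x].
  by rewrite -mulrDr ler_wpM2l // seminormD.
by rewrite seminormZ // mulrCA.
Qed.

(** Scaling: if [e * q x < d * p x], the multiple of [x] by [e / p x] has [q] below [d] and [p]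
    equal to [e]. *)
Lemma seminorm_dominated p q (d e : R) : seminorm p -> seminorm q -> 0 < d ->
  (forall x, q x < d -> p x < e) -> forall x, d * p x <= e * q x.
Proof.
move=> pn qn d0 qp x; rewrite leNgt; apply/negP => qpx.
have e0 : 0 < e by have := qp 0; rewrite !seminorm0 //; exact.
have px0 : 0 < p x.
  rewrite -(pmulr_rgt0 _ d0); apply: le_lt_trans qpx.
  by rewrite mulr_ge0 ?(ltW e0) ?(seminorm_ge0 _ qn).
have t0 : 0 < e / p x by rewrite divr_gt0.
have := qp (of_real k (e / p x) *: x).
rewrite !seminormZ // rabs_of_real gtr0_norm // divfK ?gt_eqF // ltxx.
suff -> : e / p x * q x < d by move=> /(_ isT).
by rewrite mulrAC ltr_pdivrMr.
Qed.

(** The maximum of the family together with 0. The last clause asks for [0 < e] because an empty [F]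
    leaves the zero seminorm. *)
Lemma seminorm_family (F : set (X -> R)) : finite_set F ->
  (forall q, F q -> seminorm q) -> exists p, [/\ seminorm p,
    forall q x, F q -> q x <= p x &
    forall x (e : R), 0 < e -> (forall q, F q -> q x < e) -> p x < e].
Proof.
move=> /finite_seqP[s ->]; elim: s => [|q s IH] Fn.
  by exists (fun=> 0); split => // *; exact: seminorm_cst0.
have [|p [pn Fp pF]] := IH.
  by move=> r rs; apply: Fn; rewrite /= inE rs orbT.
exists (fun x => Num.max (q x) (p x)); split.
- by apply: seminorm_max => //; apply: Fn; rewrite /= mem_head.
- move=> r x /=; rewrite inE => /orP[/eqP ->|rs]; rewrite le_max ?lexx //.
  by rewrite Fp ?orbT.
- move=> x e e0 Fe; rewrite gt_max Fe /= ?mem_head //; apply: pF => // r rs.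
  by apply: Fe; rewrite /= inE rs orbT.
Qed.

Lemma is_norm_eq0 p x : is_norm p -> p x <= 0 -> x = 0.
Proof.
by move=> [pn p0] px; apply: p0; apply/eqP; rewrite eq_le px seminorm_ge0.
Qed.

End Seminorms.

Section LocallyConvexTopologies.
Context (R : realType) (k : scalar_kind) (X : lmodType (scalars R k)).
Local Notation K := (scalars R k).
Implicit Types (p q : X -> R) (x y : X) (t : Topological X) (G : set (X -> R)).

Definition continuous_seminorm t p :=
  seminorm p /\ forall e : R, 0 < e -> nbhs_in t (0 : X) [set x | p x < e].

(** Local convexity in the form used throughout. One seminorm and radius 1 suffice, since continuous
    seminorms are stable under maxima and rescaling. *)
Definition by_seminorms t := forall x U, nbhs_in t x U <->
  exists2 p, continuous_seminorm t p & [set y | p (y - x) < 1] `<=` U.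

Lemma continuous_seminorm_coarser t t' p : coarser t t' ->
  continuous_seminorm t p -> continuous_seminorm t' p.
Proof. by move=> /coarserP tt' [pn pt]; split => // e /pt; exact: tt'. Qed.

Lemma continuous_seminorm_max t p q :
  continuous_seminorm t p -> continuous_seminorm t q ->
  continuous_seminorm t (fun x => Num.max (p x) (q x)).
Proof.
move=> [pn pt] [qn qt]; split; first exact: seminorm_max.
move=> e e0; apply: filterS (filterI (pt e e0) (qt e e0)).
by move=> x [/= pe qe]; rewrite gt_max pe.
Qed.

Lemma continuous_seminorm_scale t p (c : R) : 0 <= c ->
  continuous_seminorm t p -> continuous_seminorm t (fun x => c * p x).
Proof.
move=> c0 [pn pt]; split; first exact: seminorm_scale.
move=> e e0; have c1 : 0 < c + 1 by rewrite ltr_wpDl.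
apply: filterS (pt (e / (c + 1)) (divr_gt0 e0 c1)) => x /=; rewrite ltr_pdivlMr // => pe.
apply: le_lt_trans pe; rewrite mulrC ler_wpM2l ?lerDl //.
exact: seminorm_ge0.
Qed.

Lemma continuous_seminorm_le t p q : seminorm p -> continuous_seminorm t q ->
  (forall x, p x <= q x) -> continuous_seminorm t p.
Proof.
move=> pn [_ qt] pq; split => // e e0; apply: filterS (qt e e0) => x /=.
exact: le_lt_trans.
Qed.

Lemma continuous_seminorm0 t : continuous_seminorm t (fun=> 0).
Proof.
split; first exact: seminorm_cst0.
by move=> e e0; apply: filterS filterT => x _.
Qed.

Section BySeminorms.
Variable t : Topological X.
Hypothesis tP : by_seminorms t.

Lemma nbhs_seminorm p x (e : R) : continuous_seminorm t p -> 0 < e ->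
  nbhs_in t x [set y | p (y - x) < e].
Proof.
move=> pt e0; apply/tP; exists (fun x => e^-1 * p x).
  by apply: continuous_seminorm_scale => //; rewrite invr_ge0 ltW.
by move=> y /=; rewrite mulrC ltr_pdivrMr // mul1r.
Qed.

Lemma open_seminorm_ball p x (e : R) : continuous_seminorm t p ->
  opens t [set y | p (y - x) < e].
Proof.
move=> pt; apply/opensP => y /= pyx.
have pyx0 : 0 < e - p (y - x) by rewrite subr_gt0.
apply: filterS (nbhs_seminorm y pt pyx0) => z /= pzy.
by apply: le_lt_trans (seminormB _ y _ (proj1 pt)) _; rewrite -ltrBrDr.
Qed.

Lemma by_seminorms_linear : linear_topology t.
Proof.
split => [[x y] U /tP[p pt pU]|[a x] U /tP[p pt pU]].
  have h0 : 0 < 2^-1 :> R by rewrite invr_gt0.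
  exists ([set x' | p (x' - x) < 2^-1], [set y' | p (y' - y) < 2^-1]).
    by split; exact: nbhs_seminorm.
  move=> [x' y'] [/= px py]; apply: pU => /=.
  rewrite opprD addrACA; apply: le_lt_trans (seminormD _ _ (proj1 pt)) _.
  by rewrite (splitr 1) div1r ltrD.
have px0 : 0 < 2 * (p x + 1).
  by rewrite mulr_gt0 // ltr_wpDl // (seminorm_ge0 _ (proj1 pt)).
have a0 : 0 < 2 * (rabs a + 1) by rewrite mulr_gt0 // ltr_wpDl // rabs_ge0.
(* The difference splits as a' (x' - x) + (a' - a) x with 1/2 allotted to each term; the bound 1 in
   [d] gives |a'| <= |a| + 1 for the first. *)
pose d : R := Num.min 1 (2 * (p x + 1))^-1.
have d0 : 0 < d by rewrite lt_min ltr01 invr_gt0.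
exists ([set a' | rnorm (a' - a) < d],
        [set x' | p (x' - x) < (2 * (rabs a + 1))^-1]).
  split; first exact: near_rnorm.
  by apply: nbhs_seminorm; rewrite ?invr_gt0.
move=> [a' x'] [/=]; rewrite lt_min => /andP[a1 aa] px; apply: pU => /=.
rewrite (_ : _ - _ = a' *: (x' - x) + (a' - a) *: x); last first.
  by rewrite scalerBl scalerBr addrA subrK.
apply: le_lt_trans (seminormD _ _ (proj1 pt)) _.
rewrite !(seminormZ _ _ (proj1 pt)) (splitr 1) !div1r.
have aa' : rabs a' <= rabs a + 1.
  have := ler_rnormB (a' : K^o) a 0; rewrite !subr0 !rnorm_scalars.
  by move=> /le_trans; apply; rewrite addrC lerD2l ltW.
rewrite ltr_leD //.
  apply: le_lt_trans (ler_wpM2r (seminorm_ge0 _ (proj1 pt)) aa') _.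
  rewrite -ltr_pdivlMl // ?ltr_wpDl ?rabs_ge0 //.
  by rewrite -invfM mulrC.
apply: (@le_trans _ _ ((2 * (p x + 1))^-1 * (p x + 1))).
  apply: ler_pM; rewrite ?rabs_ge0 ?(seminorm_ge0 _ (proj1 pt)) ?lerDl //.
  exact: ltW.
by rewrite invfM -mulrA mulVf ?mulr1 // gt_eqF // ltr_wpDl // (seminorm_ge0 _ (proj1 pt)).
Qed.

Lemma by_seminorms_convex : exists2 B : set_system (top t),
  (forall b, b \in B -> convex_set (b : set (convex_lmodType X))) & basis B.
Proof.
exists [set b | exists x p, continuous_seminorm t p /\
                            b = [set y | p (y - x) < 1]].
  move=> _ /set_mem[x [p [[pn pt] ->]]] y z l.
  rewrite !inE /= => py pz.
  have l0 : 0 <= (l%:inum : K) by [].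
  have l1 : (l%:inum : K) <= 1 by [].
  rewrite /conv /=.
  move: l0 l1; set a : K := l%:inum => a0 a1.
  rewrite (_ : _ - x = a *: (y - x) + (1 - a) *: (z - x)); last first.
    by rewrite !scalerBr addrACA -opprD -scalerDl subrKC scale1r.
  apply: le_lt_trans (seminormD _ _ pn) _; rewrite !seminormZ //.
  have e1 : 1 = rabs a + rabs (1 - a).
    apply: (@of_real_inj R k).
    by rewrite of_realD -!norm_rabs !ger0_norm ?subr_ge0 // subrKC of_real1.
  (* Strictness is taken from the first summand, which vanishes together with [a]. *)
  have [a00|a00] := eqVneq a 0.
    by rewrite a00 rabs0 mul0r add0r subr0 rabs1 mul1r.
  rewrite [ltRHS]e1; apply: ltr_leD.
    by rewrite -[ltRHS]mulr1 ltr_pM2l // lt_neqAle eq_sym rabs_eq0 a00 rabs_ge0.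
  by rewrite -[leRHS]mulr1 ler_wpM2l ?rabs_ge0 // ltW.
split=> [_ [x [p [pt ->]]]|x U /tP[p pt pU]]; first exact: open_seminorm_ball.
exists [set y | p (y - x) < 1] => //; split; first by exists x, p.
by rewrite /= subrr (seminorm0 (proj1 pt)).
Qed.

Lemma by_seminorms_hausdorff :
  (forall x, (forall p, continuous_seminorm t p -> p x = 0) -> x = 0) ->
  hausdorff_space (top t).
Proof.
move=> sep x y clxy; apply: (@subr0_eq X); apply: sep => p pt.
apply/eqP; rewrite eq_le (seminorm_ge0 _ (proj1 pt)) andbT leNgt.
apply/negP => pxy; have pxy2 : 0 < p (x - y) / 2 by rewrite divr_gt0.
have [z [/= zx zy]] := clxy _ _ (nbhs_seminorm x pt pxy2) (nbhs_seminorm y pt pxy2).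
have := seminormB x z y (proj1 pt).
rewrite leNgt => /negP; apply; rewrite [ltRHS]splitr ltrD //.
by rewrite (seminormBC _ _ (proj1 pt)).
Qed.

Lemma continuous_seminorm_continuous p : continuous_seminorm t p ->
  continuous (p : top t -> R^o).
Proof.
move=> pt x U /nbhs_ballP[e /= e0 eU].
apply: filterS (nbhs_seminorm x pt e0) => y /= pyx; apply: eU.
rewrite /ball /=; apply: le_lt_trans pyx; rewrite ler_norml; apply/andP; split.
  rewrite -lerN2 opprK opprB lerBlDr; exact: seminorm_le (proj1 pt).
by rewrite lerBlDr (seminormBC _ _ (proj1 pt)); exact: seminorm_le (proj1 pt).
Qed.

End BySeminorms.

Lemma continuous_seminormP t p : seminorm p -> continuous (p : top t -> R^o) ->
  continuous_seminorm t p.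
Proof.
move=> pn pt; split => // e e0.
have pe : nbhs_in t (0 : X) (p @^-1` ball (p 0 : R^o) e).
  exact/pt/nbhsx_ballx.
apply: filterS pe => x /=; rewrite /ball /= seminorm0 // sub0r normrN.
by rewrite ger0_norm // seminorm_ge0.
Qed.

Lemma coarser_seminorms t t' : by_seminorms t -> by_seminorms t' ->
  (forall p, continuous_seminorm t p -> continuous_seminorm t' p) ->
  coarser t t'.
Proof.
move=> tP t'P tt'; apply/coarserP => x U /tP[p /tt' pt' pU].
by apply: filterS pU _; exact: nbhs_seminorm.
Qed.

Section GeneratedBy.
Variable G : set (X -> R).
Hypothesis Gn : forall q, G q -> seminorm q.

Lemma nbhs_generated_by x U : nbhs_in (generated_by G) x U <->
  exists2 F : set (X -> R), finite_set F /\ F `<=` G &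
    exists2 e : R, 0 < e & [set y | forall q, F q -> q (y - x) < e] `<=` U.
Proof.
split=> [/nbhs_opens[V [oV Vx VU]]|[F [fF FG] [e e0 eU]]].
  have [F FG [e e0 eV]] := oV x Vx.
  by exists F => //; exists e => // y /eV/VU.
apply/nbhs_opens; exists [set y | forall q, F q -> q (y - x) < e]; split => //.
  move=> y /= yF.
  have [||p [pn Fp pF]] := @seminorm_family _ _ _ F; [by []|by move=> q /FG/Gn|].
  exists F => //; exists (e - p (y - x)); first by rewrite subr_gt0 pF.
  move=> z zF q Fq; have := zF q Fq; rewrite ltrBrDr; apply: le_lt_trans.
  apply: le_trans (seminormB _ y _ (Gn (FG _ Fq))) _.
  by rewrite lerD2l; exact: Fp.
by move=> q Fq /=; rewrite subrr seminorm0 //; exact/Gn/FG.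
Qed.

Lemma continuous_seminorm_generated_by q : G q ->
  continuous_seminorm (generated_by G) q.
Proof.
move=> Gq; split; first exact: Gn.
move=> e e0; apply/nbhs_generated_by; exists [set q].
  by split; [exact: finite_set1|move=> _ ->].
by exists e => // y /(_ _ erefl) /=; rewrite subr0.
Qed.

Lemma by_seminorms_generated_by : by_seminorms (generated_by G).
Proof.
move=> x U; split => [/nbhs_generated_by[F [fF FG] [e e0 eU]]|[p [pn pG] pU]].
  have [||p [pn Fp pF]] := @seminorm_family _ _ _ F; [by []|by move=> q /FG/Gn|].
  exists (fun y => e^-1 * p y).
    apply: continuous_seminorm_scale; first by rewrite invr_ge0 ltW.
    split => // d d0; apply/nbhs_generated_by; exists F => //.
    by exists d => // y yF; apply: pF => // q /yF; rewrite subr0.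
  move=> y /=; rewrite mulrC ltr_pdivrMr // mul1r => py.
  by apply: eU => q Fq; apply: le_lt_trans py; exact: Fp.
have /nbhs_generated_by[F FG [e e0 eF]] := pG 1 ltr01.
apply/nbhs_generated_by; exists F => //; exists e => // y yF; apply: pU.
by apply: eF => q /yF; rewrite subr0.
Qed.

Lemma generated_by_coarser t : by_seminorms t ->
  (forall q, G q -> continuous_seminorm t q) -> coarser (generated_by G) t.
Proof.
move=> tP Gt; apply/coarserP => x U /nbhs_generated_by[F [fF FG] [e e0 eU]].
apply: filterS eU _.
move: fF FG => /finite_seqP[s ->] {F}; elim: s => [_|q s IH sG].
  by apply: filterS filterT => y _ q.
have qG : G q by apply: sG; rewrite /= mem_head.
have sG' : [set` s] `<=` G by move=> r rs; apply: sG; rewrite /= inE rs orbT.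
apply: filterS (filterI (nbhs_seminorm tP x (Gt _ qG) e0) (IH sG')).
move=> y [/= qy sy] r; rewrite inE => /orP[/eqP -> //|].
exact: sy.
Qed.

End GeneratedBy.

Section NormTopology.
Variable n : X -> R.
Hypothesis nn : seminorm n.

Lemma by_seminorms_norm : by_seminorms (norm_topology n).
Proof. by apply: by_seminorms_generated_by => _ ->. Qed.

Lemma continuous_seminorm_norm p :
  continuous_seminorm (norm_topology n) p <->
  seminorm p /\ exists C : R, forall x, p x <= C * n x.
Proof.
split=> [[pn /(_ 1 ltr01)]|[pn [C pC]]].
  have gn : forall q, [set n] q -> seminorm q by move=> _ ->.
  move=> /(nbhs_generated_by gn)[F [fF Fn] [e e0 eU]]; split => //.
  exists e^-1 => x.
  rewrite -(ler_pM2l e0) mulrA divff ?gt_eqF // -[leRHS]mul1r mulrA mulr1.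
  apply: (seminorm_dominated (e := 1)) => // y ny; apply: eU => q /Fn -> /=.
  by rewrite subr0.
have nt : continuous_seminorm (norm_topology n) n.
  by apply: continuous_seminorm_generated_by => // _ ->.
have C0 : 0 <= `|C| by [].
apply: continuous_seminorm_le (continuous_seminorm_scale C0 nt) _ => // x.
by apply: le_trans (pC x) _; rewrite ler_wpM2r ?ler_norm // seminorm_ge0.
Qed.

End NormTopology.

End LocallyConvexTopologies.

(** * Mixed topologies *)

Section InfimalConvolution.
Context (R : realType) (k : scalar_kind) (X : lmodType (scalars R k)).
Variable q : nat -> X -> R.
Hypothesis qn : forall i, seminorm (q i).
Implicit Types (x y : X) (s : nat -> X).

Definition decompositions x : set R :=
  [set r | exists N s, x = \sum_(i < N) s i /\ r = \sum_(i < N) q i (s i)].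

(** The largest seminorm below every [q i]: by subadditivity, the value at [x] of any such seminorm
    is a lower bound of [decompositions x]. *)
Definition infimal_convolution x : R := inf (decompositions x).

Let lb x : has_lbound (decompositions x).
Proof.
exists 0 => _ [N [s [_ ->]]]; apply: sumr_ge0 => i _.
exact: seminorm_ge0 (qn i).
Qed.

Let decompositions_at i x : decompositions x (q i x).
Proof.
exists i.+1, (fun j => if j == i then x else 0); split.
  rewrite big_ord_recr /= eqxx big1 ?add0r // => j _.
  by rewrite ltn_eqF.
rewrite big_ord_recr /= eqxx big1 ?add0r // => j _.
by rewrite ltn_eqF // seminorm0.
Qed.

Lemma infimal_convolution_le i x : infimal_convolution x <= q i x.
Proof. by apply: ge_inf => //; exact: decompositions_at. Qed.

Lemma infimal_convolution_le_sum N s :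
  infimal_convolution (\sum_(i < N) s i) <= \sum_(i < N) q i (s i).
Proof. by apply: ge_inf => //; exists N, s. Qed.

Lemma infimal_convolution_lt x (c : R) : infimal_convolution x < c ->
  exists N s, x = \sum_(i < N) s i /\ \sum_(i < N) q i (s i) < c.
Proof.
move=> /inf_lt[|_ [N [s [xs ->]]] sc]; last by exists N, s.
by exists (q 0%N x); exact: decompositions_at.
Qed.

Lemma infimal_convolution_ge (c : R) x :
  (forall N s, x = \sum_(i < N) s i -> c <= \sum_(i < N) q i (s i)) ->
  c <= infimal_convolution x.
Proof.
move=> H; apply: lb_le_inf; first by exists (q 0%N x); exact: decompositions_at.
by move=> _ [N [s [xs ->]]]; exact: H.
Qed.

(** Padding with zeros brings two decompositions to a common length, so that they can be added term
    by term. *)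
Let pad N M s : (N <= M)%N -> exists s', \sum_(i < N) s i = \sum_(i < M) s' i /\
  \sum_(i < N) q i (s i) = \sum_(i < M) q i (s' i).
Proof.
move=> NM; exists (fun i => if (i < N)%N then s i else 0); split.
  by rewrite (big_ord_widen _ s NM) big_mkcond.
rewrite (big_ord_widen _ (fun i => q i (s i)) NM) big_mkcond; apply: eq_bigr => i _.
by case: ifPn => // _; rewrite seminorm0.
Qed.

Lemma seminorm_infimal_convolution : seminorm infimal_convolution.
Proof.
apply: seminormP => [x|x y|a x].
- apply: infimal_convolution_ge => N s _; apply: sumr_ge0 => i _.
  exact: seminorm_ge0 (qn i).
- apply/ler_addgt0Pl => e e0.
  have e2 : 0 < e / 2 by rewrite divr_gt0.
  have [N [s [xs sx]]] : exists N s, x = \sum_(i < N) s i /\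
      \sum_(i < N) q i (s i) < infimal_convolution x + e / 2.
    by apply: infimal_convolution_lt; rewrite ltrDl.
  have [M [t [yt ty]]] : exists N s, y = \sum_(i < N) s i /\
      \sum_(i < N) q i (s i) < infimal_convolution y + e / 2.
    by apply: infimal_convolution_lt; rewrite ltrDl.
  have [s' [ss' qs']] := pad s (leq_maxl N M).
  have [t' [tt' qt']] := pad t (leq_maxr N M).
  rewrite xs yt ss' tt' -big_split /=.
  apply: le_trans (infimal_convolution_le_sum _ (fun i => s' i + t' i)) _.
  apply: (@le_trans _ _ (\sum_(i < maxn N M) (q i (s' i) + q i (t' i)))).
    by apply: ler_sum => i _; exact: seminormD.
  rewrite big_split /= -qs' -qt' -tt' -ss' -xs -yt.
  apply: le_trans (lerD (ltW sx) (ltW ty)) _.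
  by rewrite addrACA -splitr addrC.
- have [a0|a0] := eqVneq a 0.
    rewrite a0 rabs0 mul0r scale0r.
    by have := infimal_convolution_le 0 0; rewrite (seminorm0 (qn _)).
  have ra : 0 < rabs a by rewrite lt_neqAle eq_sym rabs_eq0 a0 rabs_ge0.
  rewrite -ler_pdivrMl //; apply: infimal_convolution_ge => N s xs.
  rewrite ler_pdivrMl // mulr_sumr.
  have -> : a *: x = \sum_(i < N) a *: s i by rewrite xs scaler_sumr.
  apply: le_trans (infimal_convolution_le_sum _ (fun i => a *: s i)) _.
  by apply: ler_sum => i _; rewrite seminormZ.
Qed.

End InfimalConvolution.

(** * Seminorms that generate the mixed topology *)

Section MixedSeminorms.
Context (R : realType) (k : scalar_kind) (X : lmodType (scalars R k)).
Local Notation K := (scalars R k).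
Implicit Types (x y : X) (n : X -> R) (tau : Topological X).

Definition mixed_seminorm n tau (p : X -> R) := seminorm p /\
  forall M e : R, 0 < e -> exists2 q, continuous_seminorm tau q &
    forall x, n x <= M -> q x < 1 -> p x < e.

Lemma mixed_seminorm_continuous n tau p :
  continuous_seminorm tau p -> mixed_seminorm n tau p.
Proof.
move=> pt; split; first by case: pt.
move=> M e e0; exists (fun x => e^-1 * p x).
  by apply: continuous_seminorm_scale => //; rewrite invr_ge0 ltW.
by move=> x _; rewrite mulrC ltr_pdivrMr // mul1r.
Qed.

Lemma convex_combination (U : set X) (x y : X) (r : R) :
  convex_set (U : set (convex_lmodType X)) -> U x -> U y -> 0 <= r <= 1 ->
  U (of_real k r *: x + of_real k (1 - r) *: y).
Proof.
move=> cU /mem_set Ux /mem_set Uy /andP[r0 r1].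
have a0 : 0 <= of_real k r :> K by rewrite -of_real0 ler_of_real.
have a1 : of_real k r <= 1 :> K by rewrite -of_real1 ler_of_real.
have := cU x y (Itv01 a0 a1) Ux Uy.
by rewrite inE of_realD of_realN of_real1.
Qed.

(** The weight missing to 1 is given to [x]. The sum equals its total weight times a weighted mean
    [v] of the [s i] (0 if the total weight vanishes), and convexity keeps [x + v] in [U]. *)
Lemma convex_sum (U : set X) x : convex_set (U : set (convex_lmodType X)) -> U x ->
  forall (N : nat) (s : nat -> X) (m : nat -> R),
    (forall i, (i < N)%N -> 0 <= m i) -> (forall i, (i < N)%N -> U (x + s i)) ->
    \sum_(i < N) m i <= 1 -> U (x + \sum_(i < N) of_real k (m i) *: s i).
Proof.
move=> cU Ux N s m m0 Us m1.
suff [v Uv ->] : exists2 v, U (x + v) &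
    \sum_(i < N) of_real k (m i) *: s i = of_real k (\sum_(i < N) m i) *: v.
  have S0 : 0 <= \sum_(i < N) m i by apply: sumr_ge0 => i _; exact: m0.
  have : U (of_real k (\sum_(i < N) m i) *: (x + v) +
      of_real k (1 - \sum_(i < N) m i) *: x).
    by apply: convex_combination => //; rewrite S0.
  by rewrite scalerDr addrAC -scalerDl -of_realD subrKC of_real1 scale1r.
elim: N m0 Us {m1} => [_ _|N IH m0 Us].
  by exists 0; rewrite ?addr0 // !big_ord0 scaler0.
rewrite !big_ord_recr /=.
have [||v Uv ->] := IH; [by move=> i /ltnW/m0|by move=> i /ltnW/Us|].
set S := \sum_(i < N) _; set r := m N.
have S0 : 0 <= S by apply: sumr_ge0 => i _; apply/m0/ltnW/ltn_ord.
have r0 : 0 <= r by apply: m0.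
have [Sr|Sr] := eqVneq (S + r) 0.
  exists 0; rewrite ?addr0 // Sr of_real0 scaler0.
  have -> : S = 0.
    by apply/eqP; rewrite eq_le S0 andbT -Sr lerDl.
  have -> : r = 0.
    by apply/eqP; rewrite eq_le r0 andbT -Sr lerDr.
  by rewrite of_real0 !scale0r addr0.
have Sr0 : 0 < S + r by rewrite lt_neqAle eq_sym Sr addr_ge0.
pose c := S / (S + r).
exists (of_real k c *: v + of_real k (1 - c) *: s N).
  rewrite (_ : x + _ = of_real k c *: (x + v) + of_real k (1 - c) *: (x + s N)).
    apply: convex_combination => //; first exact: Us.
    by rewrite divr_ge0 ?addr_ge0 //= ler_pdivrMr // mul1r lerDl.
  by rewrite !scalerDr addrACA -scalerDl -of_realD subrKC of_real1 scale1r.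
rewrite scalerDr !scalerA -!of_realM; congr (of_real k _ *: _ + of_real k _ *: _).
  by rewrite mulrC divfK.
by rewrite mulrBr mulr1 [_ * c]mulrC divfK // [RHS]addrC addKr.
Qed.

Section Mixed.
Variables (n : X -> R) (tau : Topological X).
Hypotheses (nn : seminorm n) (tauP : by_seminorms tau).
Hypothesis taun : coarser tau (norm_topology n).
Local Notation mix := (mixed_topology n tau).

Let dominated p : continuous_seminorm tau p -> exists C : R, forall x, p x <= C * n x.
Proof.
move=> /(continuous_seminorm_coarser taun).
by case/(continuous_seminorm_norm nn).
Qed.

Let msn p : mixed_seminorm n tau p -> seminorm p. Proof. by case. Qed.

(** Since [tau] is coarser than the norm topology, q <= D n for some D. On the ball of radius 1 /
    (|D| + 1) both n <= 1 and q < 1 hold, hence p < 1 there. *)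
Lemma mixed_seminorm_le_norm p : mixed_seminorm n tau p ->
  exists C : R, forall x, p x <= C * n x.
Proof.
move=> [pn /(_ 1 1 ltr01)[q qt qp]]; have [D qD] := dominated qt.
have D1 : 0 < `|D| + 1 by rewrite ltr_wpDl.
exists (`|D| + 1) => x; rewrite -ler_pdivrMl // -[leRHS]mul1r.
apply: (seminorm_dominated pn nn); first by rewrite invr_gt0.
move=> y ny; apply: qp.
  apply: le_trans (ltW ny) _; rewrite invf_le1 // lerDr.
  exact: normr_ge0.
apply: le_lt_trans (qD y) _; apply: le_lt_trans (ler_norm _) _.
rewrite normrM (ger0_norm (seminorm_ge0 y nn)).
apply: (@le_lt_trans _ _ ((`|D| + 1) * n y)).
  by rewrite ler_wpM2r ?(seminorm_ge0 _ nn) // lerDl.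
by rewrite -ltr_pdivlMl // mulr1.
Qed.

(** This places the topology of all mixed seminorms below the mixed topology. Two points of a set
    bounded by [M] differ by at most [2 * M] in norm, so smallness of the seminorms is used on the
    ball of radius [2 * M]. *)
Let generated_candidate :
  mixed_candidate n tau (generated_by (mixed_seminorm n tau)).
Proof.
have gP := by_seminorms_generated_by msn.
have taug : coarser tau (generated_by (mixed_seminorm n tau)).
  apply: coarser_seminorms => // p pt.
  by apply: continuous_seminorm_generated_by => //; exact: mixed_seminorm_continuous.
split => //.
- exact: by_seminorms_linear.
- move=> B [M BM]; apply/coincide_onP; split=> x U Bx; last first.
    by exists U; [move/coarserP : taug; exact|exact: subIsetr].
  move=> /(nbhs_generated_by msn)[F [fF FG] [e e0 eU]].
  have [q qt qF] : exists2 q, continuous_seminorm tau q &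
      forall y, n y <= 2 * M -> q y < 1 -> forall p, F p -> p y < e.
    move: fF FG {eU} => /finite_seqP[s ->] {F}; elim: s => [_|p s IH sG].
      by exists (fun=> 0) => //; exact: continuous_seminorm0.
    have [r rs|q qt qs] := IH.
      by apply: sG; rewrite /= inE rs orbT.
    have [|_ /(_ (2 * M) e e0)[r rt rp]] := sG p; first by rewrite /= mem_head.
    exists (fun x => Num.max (q x) (r x)); first exact: continuous_seminorm_max.
    move=> y ny; rewrite gt_max => /andP[qy ry] p'.
    by rewrite /= inE => /orP[/eqP ->|/(qs y ny qy)//]; exact: rp.
  exists [set y | q (y - x) < 1]; first exact: nbhs_seminorm.
  move=> y [By qy]; apply: eU => p Fp; apply: qF => //.
  apply: le_trans (seminormD _ _ nn) _; rewrite seminormN //.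
  by rewrite mulr_natl mulr2n lerD // BM.
- apply: generated_by_coarser => //; first exact: by_seminorms_norm.
  move=> p pm; apply/continuous_seminorm_norm => //.
  by split; [exact: msn|exact: mixed_seminorm_le_norm].
Qed.

Let linear_tau : linear_topology tau := by_seminorms_linear tauP.

Lemma mixed_candidate_mixed : mixed_candidate n tau mix.
Proof. by case: (mixed_topologyP linear_tau taun). Qed.

Lemma coarser_mixed t : mixed_candidate n tau t -> coarser t mix.
Proof. by case: (mixed_topologyP linear_tau taun) => _; exact. Qed.

Lemma mixed_coincide M : coincide_on [set x | n x <= M] mix tau.
Proof. by have [_ + _ _] := mixed_candidate_mixed; apply; exists M. Qed.

Lemma continuous_seminorm_mixed p :
  continuous_seminorm mix p <-> mixed_seminorm n tau p.
Proof.
split=> [[pn pt]|pm]; last first.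
  apply: continuous_seminorm_coarser (coarser_mixed generated_candidate) _.
  exact: continuous_seminorm_generated_by.
split => // M e e0.
(* For negative [M] the ball is empty; otherwise it contains 0, the point at which the two
   topologies are compared. *)
have [M0|M0] := ltP M 0.
  exists (fun=> 0) => [|x nx]; first exact: continuous_seminorm0.
  by have := le_lt_trans nx M0; rewrite ltNge (seminorm_ge0 _ nn).
have n0M : n 0 <= M by rewrite seminorm0.
have /coincide_onP[/(_ 0 _ n0M (pt e e0))[V /tauP[q qt qV] Vp] _] := mixed_coincide M.
exists q => // x nx qx; apply: Vp; split => //; apply: qV.
by rewrite /= subr0.
Qed.

(** The infimal convolution lies below each of its terms. On {n <= M} the term with M < e (i + 1) is
    less than e as soon as [p i] is, so one [tau]-continuous seminorm controls it. *)
Lemma mixed_seminorm_infimal_convolution (p : nat -> X -> R) :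
  (forall i, continuous_seminorm tau (p i)) ->
  mixed_seminorm n tau
    (infimal_convolution (fun i x => Num.max (p i x) (i.+1%:R^-1 * n x))).
Proof.
move=> pt; set q := fun i x => _.
have qn i : seminorm (q i).
  apply: seminorm_max; first by case: (pt i).
  by apply: seminorm_scale.
split; first exact: seminorm_infimal_convolution.
move=> M e e0.
pose i := Num.trunc (`|M| / e).
have iM : M < e * i.+1%:R.
  rewrite -ltr_pdivrMl // mulrC; apply: le_lt_trans (truncnS_gt _).
  by rewrite ler_wpM2r ?invr_ge0 ?ler_norm // ltW.
exists (fun x => e^-1 * p i x).
  by apply: continuous_seminorm_scale => //; rewrite invr_ge0 ltW.
move=> x nx; rewrite mulrC ltr_pdivrMr // mul1r => px.
apply: le_lt_trans (infimal_convolution_le qn i x) _.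
rewrite gt_max px /= mulrC ltr_pdivrMr //.
exact: le_lt_trans iM.
Qed.

(** Continuity of addition provides neighbourhoods with W_{i+1} + W_{i+1} inside W_i, so a finite
    sum with j-th term in W_{j+1} stays in W_0. Coincidence with [tau] on {n <= j + 1} puts a piece
    {p_j < 1, n <= j + 1} into W_{j+1}. If the infimal convolution is below 1 at a vector, some
    decomposition of it has each of its terms in the corresponding piece. *)
Lemma nbhs_mixed x U : nbhs_in mix x U <->
  exists2 p, mixed_seminorm n tau p & [set y | p (y - x) < 1] `<=` U.
Proof.
split=> [xU|[p pm pU]]; last first.
  have gP := by_seminorms_generated_by msn.
  have /coarserP := coarser_mixed generated_candidate; apply; apply/gP.
  by exists p => //; exact: continuous_seminorm_generated_by.
have [[addm _] _ _ _] := mixed_candidate_mixed.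
have half (V : set X) : exists W : set X, nbhs_in mix (0 : X) V ->
    nbhs_in mix (0 : X) W /\ forall y z, W y -> W z -> V (y + z).
  have [V0|V0] := pselect (nbhs_in mix (0 : X) V); last by exists setT.
  have V00 : nbhs_in mix (0 + 0 : X) V by rewrite addr0.
  have [[A B] [/= A0 B0] ABV] := addm (0, 0) V V00.
  exists (A `&` B) => _; split; first exact: filterI.
  by move=> y z [Ay _] [_ Bz]; exact: (ABV (y, z)).
have {half} [h hP] := choice half.
have U0 : nbhs_in mix (0 : X) [set y | U (y + x)].
  have x0U : nbhs_in mix (0 + x : X) U by rewrite add0r.
  have [[A B] [/= A0 Bx] ABU] := addm (0, x) U x0U.
  apply: filterS A0 => y Ay; apply: (ABU (y, x)); split => //=.
  exact: (@nbhs_singleton (top mix)).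
pose W i := iter i h [set y | U (y + x)].
have W0 i : nbhs_in mix (0 : X) (W i) by elim: i => //= i /hP[].
have W00 i : W i 0 by exact: (@nbhs_singleton (top mix)).
have WS i y z : W i.+1 y -> W i.+1 z -> W i (y + z).
  by have [_] := hP _ (W0 i); exact.
have sumW N i s : (forall j, (j < N)%N -> W (i + j).+1 (s j)) ->
    W i (\sum_(j < N) s j).
  elim: N i s => [|N IH] i s sW; first by rewrite big_ord0.
  rewrite big_ord_recl; apply: WS; first by have := sW 0%N; rewrite addn0; exact.
  apply: (IH _ (fun j => s j.+1)) => j jN.
  by have := sW j.+1; rewrite addnS addSn; exact.
have /choice[p pP] : forall i, exists p, continuous_seminorm tau p /\
    forall y, n y <= i.+1%:R -> p y < 1 -> W i.+1 y.
  move=> i; have n0i : n 0 <= i.+1%:R by rewrite seminorm0.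
  have /coincide_onP[/(_ 0 _ n0i (W0 i.+1))[V /tauP[p pt pV] Vp] _] :=
    mixed_coincide i.+1%:R.
  exists p; split => // y ny py; apply: Vp; split => //; apply: pV.
  by rewrite /= subr0.
have pt i : continuous_seminorm tau (p i) by case: (pP i).
exists (infimal_convolution (fun i x => Num.max (p i x) (i.+1%:R^-1 * n x))).
  exact: mixed_seminorm_infimal_convolution.
have qn i : seminorm (fun x => Num.max (p i x) (i.+1%:R^-1 * n x)).
  by apply: seminorm_max; [case: (pt i)|exact: seminorm_scale].
move=> y /(infimal_convolution_lt qn)[N [s [yxs sN]]].
suff : W 0%N (\sum_(i < N) s i) by rewrite -yxs /W /= subrK.
apply: sumW => j jN; rewrite add0n.
have : Num.max (p j (s j)) (j.+1%:R^-1 * n (s j)) < 1.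
  apply: le_lt_trans sN; rewrite (bigD1 (Ordinal jN)) //= lerDl.
  by apply: sumr_ge0 => l _; exact: (seminorm_ge0 _ (qn l)).
rewrite gt_max => /andP[pj nj]; apply: (pP j).2 => //.
by move: nj; rewrite mulrC ltr_pdivrMr // mul1r => /ltW.
Qed.

Lemma by_seminorms_mixed : by_seminorms mix.
Proof.
move=> x U; split=> [/nbhs_mixed[p pm pU]|[p pm pU]].
  by exists p => //; apply/continuous_seminorm_mixed.
by apply/nbhs_mixed; exists p => //; apply/continuous_seminorm_mixed.
Qed.

End Mixed.
End MixedSeminorms.

(** * Convergence and convex open sets in the mixed topology *)

Section MixedNeighbourhoods.
Context (R : realType) (k : scalar_kind) (X : lmodType (scalars R k)).
Local Notation K := (scalars R k).
Implicit Types (x y : X).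

(** Each of the two mixed topologies is a candidate in the definition of the other. *)
Lemma mixed_topology_eq (n : X -> R) (tau tau' : Topological X) :
  seminorm n -> by_seminorms tau -> by_seminorms tau' ->
  coarser tau tau' -> coarser tau' (norm_topology n) ->
  (forall B, norm_bounded n B -> coincide_on B tau' tau) ->
  opens (mixed_topology n tau) = opens (mixed_topology n tau').
Proof.
move=> nn tauP tau'P tt' t'n co.
have tn : coarser tau (norm_topology n) by move=> U /tt'/t'n.
have l := by_seminorms_linear tauP; have l' := by_seminorms_linear tau'P.
have [[m1 m2 m3 m4] mf] := mixed_topologyP l tn.
have [[m1' m2' m3' m4'] mf'] := mixed_topologyP l' t'n.
apply/opens_eqP; split; last first.
  apply: mf; split => // [B bB|U /tt'/m3' //].
  exact: coincide_on_trans (m2' _ bB) (co _ bB).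
apply: mf'; split => // [B bB|].
  apply: coincide_on_trans (m2 _ bB) _.
  by rewrite /coincide_on (co _ bB).
(* [tau'] is itself a candidate over [tau], hence coarser than the mixed topology of [tau]. *)
apply: mf; split => //.
Qed.

Variables (n : X -> R) (tau : Topological X).
Hypotheses (nn : seminorm n) (tauP : by_seminorms tau).
Hypothesis taun : coarser tau (norm_topology n).
Local Notation mix := (mixed_topology n tau).

Let nbhs_mixed' := nbhs_mixed nn tauP taun.
Let csn_mixed := continuous_seminorm_mixed nn tauP taun.

Lemma nondecreasing_seminorms (t : Topological X) (p : nat -> X -> R) :
  (forall i, continuous_seminorm t (p i)) ->
  exists p' : nat -> X -> R, [/\ forall i, continuous_seminorm t (p' i),
    forall i x, p i x <= p' i x &
    forall i j x, (i <= j)%N -> p' i x <= p' j x].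
Proof.
move=> pt; pose p' := fix f i x : R :=
  if i is j.+1 then Num.max (f j x) (p j.+1 x) else p 0%N x.
exists p'; split.
- elim=> [|i IH]; first exact: pt.
  exact: continuous_seminorm_max.
- by case=> [|i] x //=; rewrite le_max lexx orbT.
- move=> i j x; elim: j => [|j IH]; first by rewrite leqn0 => /eqP ->.
  rewrite leq_eqVlt => /orP[/eqP -> //|/IH /le_trans]; apply.
  by rewrite /= le_max lexx.
Qed.

(* Wiweger's argument: with [p] nondecreasing, the tail beyond [m] of a
   decomposition is small for [p m], and the head is small for [n]. *)
Lemma mixed_closed_nbhs U : nbhs_in mix (0 : X) U ->
  exists2 Q, mixed_seminorm n tau Q & forall x,
    (forall r, continuous_seminorm tau r -> exists2 y, Q y < 1 & r (x - y) < 1) ->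
    U x.
Proof.
move=> /nbhs_mixed'[P Pm PU].
have Pn : seminorm P by case: Pm.
(* The budget is 1/4 for the head [h] and 2/4 for [x - h], which leaves [P x] below 1. *)
have q4 : 0 < 4^-1 :> R by rewrite invr_gt0.
have /choice[p0 p0P] : forall i : nat, exists p, continuous_seminorm tau p /\
    forall y, n y <= i.+1%:R -> p y < 1 -> P y < 4^-1.
  by move=> i; have [_ /(_ i.+1%:R _ q4)[p pt pP]] := Pm; exists p.
have [p [pt p0p pnd]] := nondecreasing_seminorms (fun i => (p0P i).1).
pose q i x := Num.max (p i x) (i.+1%:R^-1 * n x).
have qn i : seminorm (q i).
  by apply: seminorm_max; [case: (pt i)|exact: seminorm_scale].
have pn i : seminorm (p i) by case: (pt i).
have i0 (i : nat) : 0 < i.+1%:R :> R by [].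
have Pq i x : P x <= 4^-1 * q i x.
  rewrite -[leLHS]mul1r; apply: seminorm_dominated => // y.
  rewrite gt_max => /andP[py ny]; apply: (p0P i).2.
    by move: ny; rewrite mulrC ltr_pdivrMr // mul1r => /ltW.
  exact: le_lt_trans (p0p i y) py.
exists (infimal_convolution q); first exact: mixed_seminorm_infimal_convolution.
move=> x xQ; apply: PU; rewrite /= subr0.
(* With n x <= m + 1 and n h <= m + 1 the rest has n (x - h) <= 2 (m + 1); as [p m] bounds [x - y]
   and the tail by 1 each, [q m (x - h)] is at most 2. *)
pose m := Num.trunc (n x).
have xm : n x <= m.+1%:R by apply/ltW/truncnS_gt.
have [y /(infimal_convolution_lt qn)[N [s [ys sN]]] pxy] := xQ _ (pt m).
pose h := \sum_(i < N | (i <= m)%N) s i.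
have split_sum (F : nat -> R) : \sum_(i < N) F i =
    \sum_(i < N | (i <= m)%N) F i + \sum_(i < N | ~~ (i <= m)%N) F i.
  by rewrite (bigID (fun i : 'I_N => (i <= m)%N)).
have q_ge0 i z : 0 <= q i z by exact: seminorm_ge0 (qn i).
have head1 : \sum_(i < N | (i <= m)%N) q i (s i) < 1.
  apply: le_lt_trans sN; rewrite (split_sum (fun i => q i (s i))) lerDl.
  by apply: sumr_ge0 => i _.
have tail1 : \sum_(i < N | ~~ (i <= m)%N) q i (s i) < 1.
  apply: le_lt_trans sN; rewrite (split_sum (fun i => q i (s i))) lerDr.
  by apply: sumr_ge0 => i _.
have Ph : P h <= 4^-1.
  apply: le_trans (seminorm_sum _ _ _ Pn) _.
  apply: (@le_trans _ _ (\sum_(i < N | (i <= m)%N) 4^-1 * q i (s i))).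
    by apply: ler_sum => i _; exact: Pq.
  by rewrite -mulr_sumr -[leRHS]mulr1 ler_wpM2l // ltW.
have nh : n h <= m.+1%:R.
  apply: le_trans (seminorm_sum _ _ _ nn) _.
  apply: (@le_trans _ _ (\sum_(i < N | (i <= m)%N) m.+1%:R * q i (s i))).
    apply: ler_sum => i im.
    apply: (@le_trans _ _ (i.+1%:R * q i (s i))).
      by rewrite -ler_pdivrMl // le_max lexx orbT.
    by rewrite ler_wpM2r // ler_nat.
  by rewrite -mulr_sumr -[leRHS]mulr1 ler_wpM2l // ltW.
have pxh : p m (x - h) <= 2.
  have -> : x - h = (x - y) + \sum_(i < N | ~~ (i <= m)%N) s i.
    rewrite ys (bigID (fun i : 'I_N => (i <= m)%N)) /= -/h opprD addrA subrK //.
  apply: le_trans (seminormD _ _ (pn m)) _.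
  rewrite (_ : 2 = 1 + 1) //; apply: lerD; first exact: ltW.
  apply: le_trans (seminorm_sum _ _ _ (pn m)) _.
  apply: le_trans (ltW tail1); apply: ler_sum => i; rewrite -ltnNge => mi.
  by apply: le_trans (pnd m i _ (ltnW mi)) _; rewrite le_max lexx.
have qxh : q m (x - h) <= 2.
  rewrite ge_max pxh /= ler_pdivrMl // mulrC mulr_natl mulr2n.
  by apply: le_trans (seminormD _ _ nn) _; rewrite seminormN // lerD.
apply: le_lt_trans (seminorm_le x h Pn) _.
apply: le_lt_trans (lerD (le_trans (Pq m _) (ler_wpM2l (ltW q4) qxh)) Ph) _.
lra.
Qed.

(** Convergence for [tau] suffices. If [A] in [F] is small for [Q] and [g] is in [A], then g - x is
    a [tau]-limit of differences g - h with [h] in [A], and [mixed_closed_nbhs] absorbs such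
    limits. *)
Lemma mixed_cvg (F : set_system X) x : ProperFilter F -> cauchy_filter mix F ->
  (forall r, continuous_seminorm tau r -> F [set y | r (y - x) < 1]) ->
  F --> (x : top mix).
Proof.
move=> FF Fc Fx U /nbhs_mixed'[P Pm PU].
have [|Q Qm QP] := @mixed_closed_nbhs [set y | P y < 1].
  by have /csn_mixed[_] := Pm; exact.
have Q0 : nbhs_in mix (0 : X) [set y | Q y < 1].
  by have /csn_mixed[_] := Qm; exact.
have [A FA QA] := Fc _ Q0.
rewrite nbhs_filterE; apply: filterS (FA) => g Ag; apply: PU; apply: QP => r rt.
have [h [rh Ah]] := filter_ex (filterI (Fx r rt) FA).
exists (g - h); first exact: QA.
by rewrite opprB addrC addrA subrK.
Qed.

(** If the part of U - x in {n <= i + 1} were not a [tau]-neighbourhood of 0 there, points y_j of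
    this ball with (j + 1) r'_j (y_j) < 1 would stay outside U - x. The factor j + 1 beats every
    constant in q <= C r_l, so x + y_j tends to x for [tau] and, being norm-bounded, for the mixed
    topology, against sequential openness. Convexity then assembles the pieces obtained for all
    i. *)
Lemma mixed_C_sequential (r : nat -> X -> R) :
  (forall i, continuous_seminorm tau (r i)) ->
  (forall q, continuous_seminorm tau q -> exists i, exists C : R,
     forall x, q x <= C * r i x) ->
  saks_C_sequential n tau.
Proof.
move=> rt rcof U cU sU.
have [r' [r't rr' r'nd]] := nondecreasing_seminorms rt.
apply/opensP => x Ux.
have r'n i : seminorm (r' i) by case: (r't i).
have /choice[p pP] : forall i : nat, exists p, continuous_seminorm tau p /\
    forall y, n y <= i.+1%:R -> p y < 1 -> U (x + y).
  move=> i; apply: contrapT => noP.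
  have /choice[y yP] : forall j : nat, exists y,
      [/\ n y <= i.+1%:R, j.+1%:R * r' j y < 1 & ~ U (x + y)].
    move=> j; apply: contrapT => noy; apply: noP.
    exists (fun y => j.+1%:R * r' j y); split.
      exact: continuous_seminorm_scale.
    by move=> y ny ry; apply: contrapT => Uy; apply: noy; exists y.
  have : (fun j => x + y j : X) @ \oo --> (x : top mix).
    move=> V xV; pose M := n x + i.+1%:R.
    have nxM : n x <= M by rewrite lerDl.
    have /coincide_onP[/(_ x V nxM xV)[W /tauP[q qt qW] WV] _] :=
      mixed_coincide tauP taun M.
    have [l [C qC]] := rcof q qt.
    suff : \forall j \near \oo, V (x + y j) by [].
    near=> j; apply: WV; split.
      rewrite /=; apply: le_trans (seminormD _ _ nn) _; rewrite lerD2l.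
      by case: (yP j).
    apply: qW; rewrite /= addrAC subrr add0r.
    apply: le_lt_trans (qC _) _.
    have lj : (l <= j)%N by near: j; exact: nbhs_infty_ge.
    have [_ + _] := yP j; apply: le_lt_trans.
    apply: (@le_trans _ _ (j.+1%:R * r l (y j))).
      rewrite ler_wpM2r ?(seminorm_ge0 _ (proj1 (rt l))) //.
      apply: (@le_trans _ _ j%:R); last by rewrite ler_nat.
      near: j; exact: nbhs_infty_ger.
    rewrite ler_wpM2l //; apply: le_trans (rr' l _) (r'nd _ _ _ lj).
  move=> /(sU x _ Ux)[j0 _ /(_ j0 (leqnn _))].
  by case: (yP j0).
have pt i : continuous_seminorm tau (p i) by case: (pP i).
apply/nbhs_mixed'; pose q i x := Num.max (p i x) (i.+1%:R^-1 * n x).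
exists (infimal_convolution q); first exact: mixed_seminorm_infimal_convolution.
have qn i : seminorm (q i).
  by apply: seminorm_max; [case: (pt i)|exact: seminorm_scale].
move=> y /(infimal_convolution_lt qn)[N [s [ys sN]]].
(* The slack is spread over the terms, so that each weight is positive and strictly above
   [q i (s i)] while the total stays at most 1; [N.+1] keeps the quotient meaningful for an empty
   decomposition. *)
pose d := (1 - \sum_(i < N) q i (s i)) / N.+1%:R.
have d0 : 0 < d by rewrite divr_gt0 ?subr_gt0.
pose m i := q i (s i) + d.
have q_ge0 i z : 0 <= q i z by exact: seminorm_ge0 (qn i).
have m0 i : 0 < m i by rewrite ltr_wpDl.
have -> : y = x + \sum_(i < N) of_real k (m i) *: (of_real k (m i)^-1 *: s i).
  rewrite -[y](subrK x) addrC ys; congr (_ + _); apply: eq_bigr => i _.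
  by rewrite scalerA -of_realM divff ?gt_eqF // of_real1 scale1r.
apply: (@convex_sum _ _ _ U x _ _ N (fun i => of_real k (m i)^-1 *: s i)) => //.
- by move=> i _; exact: ltW.
- move=> i _; have : q i (of_real k (m i)^-1 *: s i) < 1.
    rewrite seminormZ // rabs_of_real gtr0_norm ?invr_gt0 //.
    by rewrite mulrC ltr_pdivrMr // mul1r ltrDl.
  rewrite gt_max => /andP[pi ni]; apply: (pP i).2 => //.
  by move: ni; rewrite mulrC ltr_pdivrMr // mul1r => /ltW.
- rewrite big_split /= sumr_const card_ord -mulr_natr /d.
  rewrite -lerBrDl -mulrA ler_piMr ?subr_ge0 ?(ltW sN) //.
  by rewrite mulrC ler_pdivrMr // mul1r ler_nat.
Unshelve. all: by end_near. Qed.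

End MixedNeighbourhoods.

(** * Saks spaces *)

Section SaksSpaceCriteria.
Context (R : realType) (k : scalar_kind) (X : lmodType (scalars R k)).
Local Notation K := (scalars R k).
Implicit Types (x y : X).

(** The supremum condition of a Saks space without a chosen system: the continuous seminorms below
    [n] are stable under maxima, hence directed. *)
Definition norming (n : X -> R) (tau : Topological X) := forall x c, c < n x ->
  exists q, [/\ continuous_seminorm tau q, forall y, q y <= n y & c < q x].

Variables (n : X -> R) (tau : Topological X).
Hypotheses (nn : is_norm n) (tauP : by_seminorms tau).
Hypothesis taun : coarser tau (norm_topology n).
Local Notation mix := (mixed_topology n tau).

Let ns : seminorm n := proj1 nn.
Let mixP := by_seminorms_mixed ns tauP taun.
Let csn_mixed := continuous_seminorm_mixed ns tauP taun.
Let linear_tau : linear_topology tau := by_seminorms_linear tauP.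

Section Norming.
Hypothesis nnorming : norming n tau.

Let separated x : (forall p, continuous_seminorm tau p -> p x = 0) -> x = 0.
Proof.
move=> px; apply: (is_norm_eq0 nn); rewrite leNgt; apply/negP => /nnorming[q [qt _]].
by rewrite px // ltxx.
Qed.

(** The system consists of all continuous seminorms below [n]. It generates [tau] because every
    continuous seminorm is dominated by a multiple of [n], hence is a multiple of a member of the
    system. *)
Lemma saks_space_norming : saks_space n tau.
Proof.
split => //.
  split; [exact: linear_tau|exact: by_seminorms_convex|].
  exact: by_seminorms_hausdorff.
pose G := [set q | continuous_seminorm tau q /\ forall x, q x <= n x].
have Gn q : G q -> seminorm q by case=> -[].
exists G; split.
- split.
    exists (fun=> 0); split; first exact: continuous_seminorm0.
    by move=> x; exact: seminorm_ge0.
  move=> p q [pt pn] [qt qn]; exists (fun x => Num.max (p x) (q x)).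
  split => [|x|x]; rewrite ?le_max ?lexx ?orbT //.
  split; first exact: continuous_seminorm_max.
  by move=> x; rewrite ge_max pn qn.
- move=> q [qt _]; split; first by case: qt.
  exact: continuous_seminorm_continuous.
- apply/opens_eqP; split; last by apply: generated_by_coarser => // q [].
  apply: coarser_seminorms => //; first exact: by_seminorms_generated_by.
  move=> p pt; have pn : seminorm p by case: pt.
  have /(continuous_seminorm_norm ns)[_ [C pC]] := continuous_seminorm_coarser taun pt.
  have C1 : 0 < `|C| + 1 by rewrite ltr_wpDl.
  have Gp : G (fun x => (`|C| + 1)^-1 * p x).
    split; first by apply: continuous_seminorm_scale => //; rewrite invr_ge0 ltW.
    move=> x; rewrite ler_pdivrMl //; apply: le_trans (pC x) _.
    rewrite ler_wpM2r ?(seminorm_ge0 _ ns) //.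
    by rewrite (le_trans (ler_norm C)) // lerDl.
  have := continuous_seminorm_scale (ltW C1) (continuous_seminorm_generated_by Gn Gp).
  move=> /continuous_seminorm_le; apply => // x.
  by rewrite mulrA divff ?mul1r // gt_eqF.
- move=> x; apply/eqP; rewrite eq_le; apply/andP; split.
    apply/lee_addgt0Pr => e e0.
    have [|q [qt qn qx]] := nnorming (x := x) (c := n x - e).
      by rewrite ltrBlDr ltrDl.
    apply: (@le_trans _ _ ((q x)%:E + e%:E)%E).
      by rewrite -EFinD lee_fin -lerBlDr ltW.
    by rewrite leeD2r //; apply: ereal_sup_ubound; exists q.
  by apply: ge_ereal_sup => _ [q [_ qn] <-]; rewrite lee_fin.
Qed.

Lemma mixed_hausdorff : hausdorff_space (top mix).
Proof.
apply: by_seminorms_hausdorff => // x px; apply: separated => p pt.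
by apply: px; apply/csn_mixed; exact: mixed_seminorm_continuous.
Qed.

End Norming.

Section WeightedSup.
Variables (q : nat -> X -> R) (a : nat -> R).
Hypotheses (qt : forall m, continuous_seminorm tau (q m)).
Hypotheses (qn : forall m x, q m x <= n x) (a0 : forall m, 0 <= a m).
Hypothesis acvg : a @ \oo --> (0 : R^o).

Definition weighted_sup x : R := sup [set q m x * a m | m in [set: nat]].

Let weighted_ub x : has_ubound [set q m x * a m | m in [set: nat]].
Proof.
have /cvg_seq_bounded[M [_ /(_ (M + 1))]] : cvgn (a : nat -> R^o).
  by apply/cvg_ex; exists 0.
rewrite ltrDl => /(_ ltr01) aM.
exists (n x * (M + 1)) => _ [m _ <-]; apply: ler_pM => //.
  exact: seminorm_ge0 (proj1 (qt m)).
by apply: le_trans (aM m I); exact: ler_norm.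
Qed.

Lemma weighted_sup_ge m x : q m x * a m <= weighted_sup x.
Proof. by apply: ub_le_sup => //; exists m. Qed.

Lemma weighted_sup_le x (c : R) :
  (forall m, q m x * a m <= c) -> weighted_sup x <= c.
Proof.
move=> H; apply: ge_sup; first by exists (q 0%N x * a 0%N), 0%N.
by move=> _ [m _ <-].
Qed.

(** On {n <= M} the late terms are at most M a_m, which is small because [a] is null; the finitely
    many others lie below one [tau]-continuous seminorm. *)
Lemma mixed_seminorm_weighted_sup : mixed_seminorm n tau weighted_sup.
Proof.
have qs m : seminorm (q m) by case: (qt m).
split.
  apply: seminormP => [x|x y|b x].
  - by apply: le_trans (weighted_sup_ge 0 x); rewrite mulr_ge0 // (seminorm_ge0 _ (qs _)).
  - apply: weighted_sup_le => m.
    apply: le_trans (lerD (weighted_sup_ge m x) (weighted_sup_ge m y)).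
    by rewrite -mulrDl ler_wpM2r // seminormD.
  - apply: weighted_sup_le => m; rewrite seminormZ // -mulrA.
    by rewrite ler_wpM2l ?rabs_ge0 // weighted_sup_ge.
move=> M e e0; pose M' := `|M| + 1.
have M'0 : 0 < M' by rewrite ltr_wpDl.
have e2 : 0 < e / 2 by rewrite divr_gt0.
have : \forall m \near \oo, a m < e / 2 / M'.
  by apply: (cvgr_lt _ acvg); rewrite divr_gt0.
move=> [m0 _ am].
have [p' [p't p'ge p'nd]] := nondecreasing_seminorms (t := tau)
  (fun m => continuous_seminorm_scale (a0 m) (qt m)).
exists (fun x => 2 / e * p' m0 x).
  by apply: continuous_seminorm_scale => //; rewrite divr_ge0 // ltW.
move=> x nx px; apply: (@le_lt_trans _ _ (e / 2)); last first.
  by rewrite ltr_pdivrMr // ltr_pMr // ltrDl.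
have {}px : p' m0 x < e / 2.
  by move: px; rewrite -ltr_pdivlMl ?divr_gt0 // mulr1 invf_div.
apply: weighted_sup_le => m; have [mm0|m0m] := leqP m m0.
  apply/ltW; apply: le_lt_trans px; rewrite mulrC.
  exact: le_trans (p'ge m x) (p'nd _ _ _ mm0).
apply: (@le_trans _ _ (M' * (e / 2 / M'))); last first.
  by rewrite mulrC divfK // gt_eqF.
apply: ler_pM => //; first exact: seminorm_ge0 (qs m).
  apply: le_trans (qn m x) _; apply: le_trans nx _.
  by rewrite (le_trans (ler_norm M)) // lerDl.
by apply/ltW/am; exact: ltnW.
Qed.

End WeightedSup.

(** Otherwise there are x_m in [B] and continuous q_m <= n with q_m (x_m) > (m + 1)^2. The weighted
    supremum with a_m = 1 / (m + 1) is mixed continuous and exceeds m + 1 at x_m; the square is what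
    survives the weight. *)
Lemma mixed_bounded (B : set X) : norming n tau ->
  von_neumann_bounded mix B -> norm_bounded n B.
Proof.
move=> nnorming vB; apply: contrapT => nB.
have /choice[x xP] : forall m : nat, exists x, B x /\ m.+1%:R ^+ 2 < n x.
  move=> m; apply: contrapT => nx; apply: nB; exists (m.+1%:R ^+ 2) => y By.
  by rewrite leNgt; apply/negP => yn; apply: nx; exists y.
have /choice[q qP] : forall m : nat, exists q, [/\ continuous_seminorm tau q,
    forall y, q y <= n y & m.+1%:R ^+ 2 < q (x m)].
  by move=> m; apply: nnorming; case: (xP m).
have qt m : continuous_seminorm tau (q m) by case: (qP m).
have qn m y : q m y <= n y by case: (qP m).
pose a : nat -> R := fun m => m.+1%:R^-1.
have a0 m : 0 <= a m by rewrite invr_ge0.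
have acvg : a @ \oo --> (0 : R^o) by exact: cvg_harmonic.
have pm := mixed_seminorm_weighted_sup qt qn a0 acvg.
have /csn_mixed[ps /(_ 1 ltr01) /vB[r r0 rB]] := pm.
have rr : r <= rabs (of_real k r) by rewrite rabs_of_real ler_norm.
pose m := Num.trunc r.
have [Bx nx] := xP m.
have [u /= pu ux] := rB _ rr _ Bx.
have : weighted_sup q a (x m) < r.
  rewrite -ux seminormZ // rabs_of_real gtr0_norm //.
  by rewrite -[ltRHS]mulr1 ltr_pM2l.
apply/negP; rewrite -leNgt; apply: le_trans (weighted_sup_ge qt qn a0 acvg m (x m)).
apply: (@le_trans _ _ m.+1%:R); first exact/ltW/truncnS_gt.
rewrite ler_pdivlMr // -expr2; apply/ltW; by case: (qP m).
Qed.

Hypothesis ball_compact : forall M, compact ([set x | n x <= M] : set (top tau)).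

Lemma mixed_semi_montel : norming n tau -> saks_semi_montel n tau.
Proof.
move=> nnorming B /(mixed_bounded nnorming)[M BM].
exists [set x | n x <= M]; first exact: BM.
have cM : compact ([set x | n x <= M] : set (top mix)).
  apply: (@compact_coincide X [set x | n x <= M] _ tau) => //.
  by have := mixed_coincide tauP taun M; rewrite /coincide_on => ->.
by split => //; apply: compact_closed => //; exact: mixed_hausdorff.
Qed.

Let cluster_le (F : set_system (top tau)) x p (c : R) : continuous_seminorm tau p ->
  cluster F (x : top tau) -> F [set y | p y <= c] -> p x <= c.
Proof.
move=> pt clx Fp; rewrite leNgt; apply/negP => cp.
have pc0 : 0 < p x - c by rewrite subr_gt0.
have [y [/= pyc pyx]] := clx _ _ Fp (nbhs_seminorm tauP x pt pc0).
have := seminorm_le x y (proj1 pt); rewrite (seminormBC _ _ (proj1 pt)).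
rewrite leNgt => /negP; apply; rewrite -ltrBrDr.
by apply: lt_le_trans pyx _; rewrite lerD2l lerN2.
Qed.

(** * The Banach-Dieudonne construction and the submixed topology *)

Section Submixed.
Variable G : set (X -> R).
Hypothesis Gsaks : saks_system n tau G.

Let Gt q : G q -> continuous_seminorm tau q.
Proof.
by have [_ + _ _] := Gsaks => /[apply] -[qs qc]; exact: continuous_seminormP.
Qed.

Let G_le q x : G q -> q x <= n x.
Proof.
move=> Gq; have [_ _ _ /(_ x) nx] := Gsaks.
by rewrite -lee_fin nx; apply: ereal_sup_ubound; exists q.
Qed.

Let n_le x (c : R) : (forall q, G q -> q x <= c) -> n x <= c.
Proof.
move=> xc; have [_ _ _ /(_ x) nx] := Gsaks.
by rewrite -lee_fin nx; apply: ge_ereal_sup => _ [q Gq <-]; rewrite lee_fin xc.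
Qed.

Section BanachDieudonne.
Variables (P : X -> R) (d : R).
Hypotheses (Pm : mixed_seminorm n tau P).

(** A ball cut down by the constraints l_i <= d (i + 1). Each further seminorm in [l] pays for an
    increase of the radius by [d]. *)
Let cone (l : seq (X -> R)) : set X := [set x | n x <= d * (size l).+1%:R /\
  forall i, (i < size l)%N -> nth (fun=> 0) l i x <= d * i.+1%:R].

Let good l := (forall i, (i < size l)%N -> G (nth (fun=> 0) l i)) /\
  cone l `<=` [set x | P x < 1].

(* If no member of [G] extended [l], compactness of the ball would give a point
   of the previous stage outside [P < 1]. *)
Let good_rcons l : good l -> exists q, good (rcons l q).
Proof.
move=> [Gl lP]; apply: contrapT => nq.
have bad q : G q -> (cone (rcons l q) `&` [set x | 1 <= P x]) !=set0.
  move=> Gq; apply: contrapT => nx; apply: nq; exists q; split.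
    move=> i; rewrite size_rcons ltnS nth_rcons; case: ltngtP => // il _.
    exact: Gl.
  move=> x cx; rewrite /= ltNge; apply/negP => Px; apply: nx.
  by exists x.
pose F : set_system (top tau) :=
  filter_from G (fun q => cone (rcons l q) `&` [set x | 1 <= P x]).
have [[[q0 Gq0] Gdir] _ _ _] := Gsaks.
have FF : ProperFilter F.
  apply: filter_from_proper => //; apply: filter_from_filter; first by exists q0.
  move=> p q Gp Gq; have [r [Gr pr qr]] := Gdir p q Gp Gq; exists r => //.
  move=> x [[xn xr] Px]; rewrite size_rcons in xn xr.
  have xl s : G s -> (forall x, s x <= r x) -> cone (rcons l s) x.
    move=> Gs sr; split; rewrite size_rcons // => i il.
    have := xr i il; rewrite !nth_rcons; case: ltngtP => // _.
    exact: le_trans.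
  by split; split => //; apply: xl.
pose M := d * (size l).+2%:R.
have FM : F [set x | n x <= M].
  by exists q0 => // x [[]]; rewrite size_rcons.
have [x [xM clx]] := ball_compact FF FM.
(* Each [q] in [G] is eventually the last constraint along [F], so its bound d (|l| + 1) passes to
   the cluster point. As [n] is the supremum of [G], the norm of [x] drops to the radius of the
   previous stage. *)
have lx : cone l x.
  split.
    apply: n_le => q Gq; apply: (cluster_le (Gt Gq) clx); exists q => //.
    move=> y [[_ /(_ (size l))]]; rewrite size_rcons nth_rcons ltnn eqxx => + _.
    exact.
  move=> i il; apply: (cluster_le (Gt (Gl _ il)) clx); exists q0 => //.
  move=> y [[_ /(_ i)]]; rewrite size_rcons nth_rcons il ltnS => + _.
  by apply; exact: ltnW.
have /= Px := lP _ lx.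
have [_ /(_ (2 * M) (1 - P x))[|r rt rP]] := Pm; first by rewrite subr_gt0.
have FPM : F [set y | n y <= M /\ 1 <= P y].
  by exists q0 => // y [[]]; rewrite size_rcons.
have [y [[yM Py] ryx]] := clx _ _ FPM (nbhs_seminorm tauP x rt ltr01).
have Ps : seminorm P by case: Pm.
have := seminorm_le y x Ps; apply/negP; rewrite -ltNge.
apply: lt_le_trans Py; rewrite -ltrBrDr; apply: rP => //.
apply: le_trans (seminormD _ _ ns) _; rewrite seminormN //.
by rewrite mulr_natl mulr2n lerD.
Qed.

Hypotheses (d0 : 0 < d) (dP : forall x, n x <= d -> P x < 1).

(** Start from the empty list, whose stage is the ball n <= d, and extend forever. The weights 1 /
    (d (m + 1)) turn a weighted supremum below 1 into all the constraints q_i <= d (i + 1) at once,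
    so [x] lies in any stage whose radius is at least n x. *)
Lemma banach_dieudonne : exists q a, [/\ forall m, G (q m), forall m, 0 <= a m,
  a @ \oo --> (0 : R^o) & forall x, weighted_sup q a x < 1 -> P x < 1].
Proof.
have /choice[f fP] : forall l, exists q, good l -> good (rcons l q).
  move=> l; have [/good_rcons[q ?]|nl] := pselect (good l); first by exists q.
  by exists (fun=> 0).
pose L m := iter m (fun l => rcons l (f l)) [::].
have Lgood m : good (L m).
  elim: m => [|m IH]; last exact: fP.
  by split => // x [+ _]; rewrite mulr1 => /dP.
have sL m : size (L m) = m by elim: m => //= m IH; rewrite size_rcons IH.
have nthL m i : (i < m)%N -> nth (fun=> 0) (L m) i = f (L i).
  elim: m => // m IH im; rewrite /= nth_rcons sL.
  by move: im; rewrite ltnS leq_eqVlt => /orP[/eqP ->|im]; rewrite ?ltnn ?eqxx // im IH.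
have Gf m : G (f (L m)) by have := (Lgood m.+1).1 m; rewrite sL ltnS nthL //; exact.
pose a m : R := d^-1 * m.+1%:R^-1.
have a0 m : 0 <= a m by rewrite mulr_ge0 ?invr_ge0 // ltW.
have acvg : a @ \oo --> (0 : R^o).
  rewrite -(mulr0 d^-1); apply: cvgMr; exact: cvg_harmonic.
exists (fun m => f (L m)), a; split => // x x1.
pose m := Num.trunc (n x / d).
apply: (Lgood m).2; split; rewrite sL.
  by rewrite -ler_pdivrMl // mulrC; apply/ltW/truncnS_gt.
move=> i im; rewrite nthL //.
have := le_lt_trans (weighted_sup_ge (fun m => Gt (Gf m))
  (fun m x => G_le x (Gf m)) a0 acvg i x) x1.
by rewrite /a -invfM ltr_pdivrMr ?mul1r ?mulr_gt0 // => /ltW.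
Qed.

End BanachDieudonne.

Lemma mixed_submixed : opens mix = opens (submixed_topology G).
Proof.
have sub_mixed p : [set p | exists q : nat -> X -> R, exists a : nat -> R,
      [/\ forall m, G (q m), forall m, 0 <= a m, a @ \oo --> (0 : R^o)
        & p = fun x => sup [set q m x * a m | m in [set: nat]]]] p ->
    mixed_seminorm n tau p.
  move=> [q [a [Gq a0 acvg ->]]].
  exact: (mixed_seminorm_weighted_sup (fun m => Gt (Gq m))
    (fun m x => G_le x (Gq m)) a0 acvg).
have sub_seminorm p := fun Hp => proj1 (sub_mixed p Hp).
apply/opens_eqP; split; last first.
  by apply: generated_by_coarser => // p /sub_mixed/csn_mixed.
apply/coarserP => x U /(nbhs_mixed ns tauP taun)[P Pm PU].
have Ps : seminorm P by case: Pm.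
have [C PC] := mixed_seminorm_le_norm ns taun Pm.
have C1 : 0 < `|C| + 1 by rewrite ltr_wpDl.
(* P <= C n makes P < 1 on the ball of radius 1 / (|C| + 1), which is the initial stage. *)
have [||q [a [Gq a0 acvg qP]]] := @banach_dieudonne P (`|C| + 1)^-1 Pm.
- by rewrite invr_gt0.
- move=> y ny; apply: le_lt_trans (PC y) _; apply: (@le_lt_trans _ _ (`|C| * n y)).
    by rewrite ler_wpM2r ?ler_norm // (seminorm_ge0 _ ns).
  apply: (@le_lt_trans _ _ (`|C| * (`|C| + 1)^-1)); first by rewrite ler_wpM2l.
  by rewrite ltr_pdivrMr // mul1r ltrDl.
apply: filterS (fun y => PU y \o qP (y - x)) _.
apply: (@nbhs_seminorm _ _ _ (submixed_topology G)) => //.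
  exact: by_seminorms_generated_by.
apply: continuous_seminorm_generated_by => //.
by exists q, a.
Qed.

End Submixed.

End SaksSpaceCriteria.

(** * Hahn-Banach and uniform boundedness *)

Section RealFunctionals.
Context (R : realType) (k : scalar_kind) (E : normedModType (scalars R k)).
Local Notation K := (scalars R k).
Implicit Types (x y v : E) (f : E -> R).

Lemma seminorm_rnorm : seminorm (@rnorm R k E).
Proof. by split; [exact: ler_rnormD|exact: rnormZ]. Qed.

Definition real_linear f := (forall x y, f (x + y) = f x + f y) /\
  forall r x, f (of_real k r *: x) = r * f x.

(** Graphs of norm-dominated real functionals on real subspaces. Single-valuedness is a consequence:
    a pair (0, r) in the graph has r <= 0, and so does its opposite. The condition at [v] is
    conditional because the empty chain in Zorn's lemma has an empty union. *)
Definition dominated_graph (v : E) (G : set (E * R)) := [/\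
  forall z w, G z -> G w -> G (z.1 + w.1, z.2 + w.2),
  forall t z, G z -> G (of_real k t *: z.1, t * z.2),
  forall z, G z -> z.2 <= rnorm z.1 &
  G !=set0 -> G (v, rnorm v)].

Let dominated_graph_bigcup v (F : set (set (E * R))) :
  F `<=` dominated_graph v -> total_on F subset ->
  dominated_graph v (\bigcup_(G in F) G).
Proof.
move=> Fg Ft; split.
- move=> z w [G FG Gz] [H FH Hw]; have [GH|HG] := Ft _ _ FG FH.
    by exists H => //; have [+ _ _ _] := Fg _ FH; apply => //; exact: GH.
  by exists G => //; have [+ _ _ _] := Fg _ FG; apply => //; exact: HG.
- by move=> t z [G FG Gz]; exists G => //; have [_ + _ _] := Fg _ FG; apply.
- by move=> z [G FG Gz]; have [_ _ + _] := Fg _ FG; apply.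
- move=> [z [G FG Gz]]; exists G => //; have [_ _ _] := Fg _ FG; apply.
  by exists z.
Qed.

(** The value at [x] must lie between the numbers z.2 - |z.1 - x| and |z.1 + x| - z.2 for z in the
    graph; the triangle inequality separates them, and the supremum [c] of the lower ones is chosen.
    Scaling by 1 / |t| reduces z + t x to t = 1 or t = -1. *)
Let dominated_graph_extend v G x : dominated_graph v G -> G (v, rnorm v) ->
  exists2 G', dominated_graph v G' & G `<=` G' /\ exists c, G' (x, c).
Proof.
move=> [GD GZ Gn _] Gv.
have G0 : G (0, 0) by have := GZ 0 _ Gv; rewrite /= of_real0 scale0r mul0r.
pose S := [set z.2 - rnorm (z.1 - x) | z in G].
have Sub z : G z -> ubound S (rnorm (z.1 + x) - z.2).
  move=> Gz _ [w Gw <-]; rewrite lerBlDr addrAC lerBrDr [leLHS]addrC.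
  apply: le_trans (Gn _ (GD _ _ Gz Gw)) _ => /=.
  apply: le_trans (ler_rnormD _ _); rewrite [w.1 - x]addrC addrA.
  by rewrite addrK.
have S0 : S !=set0 by exists (0 - rnorm (0 - x)), (0, 0).
pose c := sup S.
have cD z : G z -> z.2 + c <= rnorm (z.1 + x).
  by move=> Gz; rewrite -lerBrDl; apply: ge_sup => //; exact: Sub.
have cB z : G z -> z.2 - c <= rnorm (z.1 - x).
  move=> Gz; rewrite lerBlDr -lerBlDl; apply: ub_le_sup; last by exists z.
  by exists (rnorm (0 + x) - 0); exact: (Sub (0, 0)).
exists [set w | exists z t, G z /\ w = (z.1 + of_real k t *: x, z.2 + t * c)].
  split.
  - move=> _ _ [z [t [Gz ->]]] [w [s [Gw ->]]] /=.
    exists (z.1 + w.1, z.2 + w.2), (t + s); split; first exact: GD.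
    by rewrite /= of_realD scalerDl mulrDl; congr pair; rewrite addrACA.
  - move=> r _ [z [t [Gz ->]]] /=.
    exists (of_real k r *: z.1, r * z.2), (r * t); split; first exact: GZ.
    by rewrite /= scalerDr scalerA of_realM mulrDr mulrA.
  - move=> _ [z [t [Gz ->]]] /=.
    have scal s y b : 0 < s -> s^-1 * b <= rnorm (of_real k s^-1 *: y) -> b <= rnorm y.
      move=> s0; rewrite rnormZ rabs_of_real gtr0_norm ?invr_gt0 //.
      by rewrite ler_pM2l // invr_gt0.
    have [t0|t0|->] := ltgtP t 0; last first.
    + by rewrite of_real0 scale0r mul0r !addr0; exact: Gn.
    + apply: (scal t) => //; rewrite scalerDr scalerA -of_realM mulrDr mulrA.
      rewrite mulVf ?gt_eqF // of_real1 scale1r mul1r.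
      exact: (cD _ (GZ t^-1 _ Gz)).
    + have t0' : 0 < - t by rewrite oppr_gt0.
      apply: (scal (- t)) => //; rewrite scalerDr scalerA -of_realM mulrDr mulrA.
      have -> : (- t)^-1 * t = -1 by rewrite invrN mulNr mulVf ?lt_eqF.
      rewrite of_realN of_real1 scaleN1r mulN1r.
      exact: (cB _ (GZ (- t)^-1 _ Gz)).
  - move=> _; exists (v, rnorm v), 0; split => //.
    by rewrite of_real0 scale0r mul0r !addr0.
split=> [z Gz|].
  exists z, 0; split => //.
  by rewrite of_real0 scale0r mul0r !addr0 -surjective_pairing.
by exists c, (0, 0), 1; rewrite of_real1 scale1r mul1r !add0r.
Qed.

Theorem real_hahn_banach v : exists f, [/\ real_linear f,
  forall x, `|f x| <= rnorm x & f v = rnorm v].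
Proof.
have [G [Gg Gmax]] := Zorn_bigcup (@dominated_graph_bigcup v).
have Gv : G (v, rnorm v).
  have [_ _ _] := Gg; apply; apply: contrapT => /set0P/negP/negPn/eqP G0.
  (* If the maximal graph were empty, the functional on the real line through [v] would properly
     extend it. *)
  pose L := [set z | exists t, z = (of_real k t *: v, t * rnorm v)].
  apply: (Gmax L).
    rewrite G0; split=> [//|/(_ (v, rnorm v))]; apply.
    by exists 1; rewrite of_real1 scale1r mul1r.
  split.
  - move=> _ _ [t ->] [s ->]; exists (t + s).
    by rewrite of_realD scalerDl mulrDl.
  - by move=> r _ [t ->]; exists (r * t); rewrite /= of_realM scalerA mulrA.
  - move=> _ [t ->] /=; rewrite rnormZ rabs_of_real.
    by rewrite ler_wpM2r ?rnorm_ge0 // ler_norm.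
  - by move=> _; exists 1; rewrite of_real1 scale1r mul1r.
have [GD GZ Gn _] := Gg.
have /choice[f Gf] : forall x, exists r, G (x, r).
  move=> x; apply: contrapT => nx.
  have [G' G'g [GG' [c G'c]]] := dominated_graph_extend x Gg Gv.
  apply: (Gmax G') => //; split => // G'G; apply: nx.
  by exists c; exact: G'G.
have GN z : G z -> G (- z.1, - z.2).
  by move=> /(GZ (-1)); rewrite of_realN of_real1 scaleN1r mulN1r.
have Gle x r s : G (x, r) -> G (x, s) -> r <= s.
  move=> xr /GN xs; have := Gn _ (GD _ _ xr xs).
  by rewrite /= subrr rnorm0 subr_le0.
have Gfun x r : G (x, r) -> f x = r.
  by move=> xr; apply/eqP; rewrite eq_le !(Gle x).
exists f; split; last exact: Gfun.
  split=> [x y|r x]; first by apply: Gfun; exact: (GD (x, f x) (y, f y)).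
  by apply: Gfun; exact: (GZ r (x, f x)).
move=> x; rewrite ler_norml; apply/andP; split; last exact: (Gn (x, f x)).
by rewrite lerNl -[rnorm x]rnormN; exact: (Gn (- x, - f x) (GN (x, f x) (Gf x))).
Qed.

(* The sign of the correction [w m * psi m] makes it at least [w m * rnorm (x m)]
   at [x m], and all later corrections together cancel at most half of that. *)
Section GlidingHump.
Variables (x : nat -> E) (psi : nat -> E -> R).
Hypotheses (psiL : forall m, real_linear (psi m)).
Hypotheses (psi_le : forall m y, `|psi m y| <= rnorm y).
Hypothesis psi_x : forall m, psi m (x m) = rnorm (x m).

(** For ratio 1/3 the terms after stage [m] sum to exactly half of [w m]; the whole series sums to
    the constant 3/2 of [gliding_hump]. *)
Let w m : R := 3^-1 ^+ m.

Fixpoint hump m : E -> R :=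
  if m is j.+1 then
    if w j * rnorm (x j) <= `|hump j (x j) + w j * rnorm (x j)|
    then fun y => hump j y + w j * psi j y
    else fun y => hump j y - w j * psi j y
  else fun=> 0.

Let w_gt0 m : 0 < w m. Proof. by rewrite exprn_gt0 // invr_gt0. Qed.

Let wS m : w m.+1 = w m / 3. Proof. by rewrite /w exprSr. Qed.

Let hump_linear m : real_linear (hump m).
Proof.
elim: m => [|m [IHD IHZ]] /=; first by split => *; rewrite ?addr0 ?mulr0.
have [pD pZ] := psiL m.
by case: ifP => _; split => [y z|r y]; rewrite ?IHD ?IHZ ?pD ?pZ; ring.
Qed.

Let humpS m y : `|hump m.+1 y - hump m y| <= w m * rnorm y.
Proof.
have wp : `|w m * psi m y| <= w m * rnorm y.
  by rewrite normrM gtr0_norm // ler_wpM2l // ltW.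
by rewrite /=; case: ifP => _; rewrite addrAC subrr add0r ?normrN.
Qed.

Let hump_at m : w m * rnorm (x m) <= `|hump m.+1 (x m)|.
Proof.
rewrite /=; case: ifPn; rewrite psi_x //.
have b0 : 0 <= w m * rnorm (x m) by rewrite mulr_ge0 ?rnorm_ge0 // ltW.
(* |a + b| < b forces a < 0, and then |a - b| >= b. *)
move: (hump m (x m)) (w m * _) b0 => a b b0.
rewrite -ltNge => /(le_lt_trans (ler_norm _)) ab.
by rewrite distrC; apply: le_trans (ler_norm _); lra.
Qed.

Let hump_dist m j y :
  `|hump (m + j) y - hump m y| <= 3 / 2 * (w m - w (m + j)) * rnorm y.
Proof.
elim: j => [|j IH]; first by rewrite addn0 !subrr normr0 mulr0 mul0r.
rewrite addnS (le_trans (ler_distD (hump (m + j) y) _ _)) //.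
apply: le_trans (lerD (humpS _ _) IH) _; rewrite wS -mulrDl.
by rewrite ler_wpM2r ?rnorm_ge0 //; lra.
Qed.

Let w_cvg : w @ \oo --> (0 : R).
Proof. by apply: cvg_expr; rewrite ger0_norm ?invr_ge0 // invf_lt1 // ltr1n. Qed.

Lemma gliding_hump : exists f, [/\ real_linear f,
  forall y, `|f y| <= 3 / 2 * rnorm y &
  forall m, 3^-1 ^+ m * rnorm (x m) <= 2 * `|f (x m)|].
Proof.
have humpc y : cvgn (fun m => hump m y).
  (* The added term drops by [w m * rnorm y] at each stage, the most that [hump] can gain, so [u] is
     nonincreasing and converges once bounded below. *)
  pose u m := hump m y + 3 / 2 * w m * rnorm y.
  have uc : cvgn u.
    apply: nonincreasing_is_cvgn.
      apply/nonincreasing_seqP => m; rewrite /u wS -lerBlDr -addrA -lerBrDl.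
      have := le_trans (ler_norm _) (humpS m y); lra.
    exists (- (3 / 2) * rnorm y) => _ [m _ <-].
    have := hump_dist 0 m y; rewrite add0n /= subr0 => /ler_normlP[+ _].
    have -> : w 0%N = 1 by [].
    have : 0 <= w m * rnorm y by rewrite mulr_ge0 ?rnorm_ge0 // ltW.
    by rewrite /u; lra.
  have wc : (fun m => 3 / 2 * w m * rnorm y) @ \oo --> (3 / 2 * 0 * rnorm y).
    by apply: cvgMl; apply: cvgMr.
  move/cvg_ex: uc => [l ul]; apply/cvg_ex; exists (l - 3 / 2 * 0 * rnorm y).
  apply: cvg_trans (cvgB ul wc); apply: near_eq_cvg; near=> m.
  by rewrite /u /= addrK.
pose f y := lim (hump m y @[m --> \oo]).
have fc y : (fun m => hump m y) @ \oo --> f y by exact: humpc.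
have fm m y : `|f y - hump m y| <= 3 / 2 * w m * rnorm y.
  have c : (fun j => `|hump j y - hump m y|) @ \oo --> `|f y - hump m y|.
    by apply: cvg_norm; apply: cvgB => //; exact: cvg_cst.
  apply: (cvgr_to_le c); near=> j.
  have /subnKC <- : (m <= j)%N by near: j; exact: nbhs_infty_ge.
  apply: le_trans (hump_dist _ _ _) _; rewrite ler_wpM2r ?rnorm_ge0 //.
  by rewrite ler_wpM2l ?divr_ge0 // gerBl ltW.
exists f; split.
- split => [y z|r y].
    apply: (cvg_unique _ (fc (y + z))) => //.
    rewrite (_ : (fun m => _) = (fun m => hump m y) \+ (fun m => hump m z)).
      exact: cvgD.
    by apply/funext => m; rewrite /= (hump_linear m).1.
  apply: (cvg_unique _ (fc (of_real k r *: y))) => //.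
  rewrite (_ : (fun m => _) = (fun m => r * hump m y)).
    exact: cvgMr.
  by apply/funext => m; rewrite /= (hump_linear m).2.
- by move=> y; have := fm 0%N y; rewrite /= subr0 /w expr0 mulr1.
- move=> m; have := hump_at m; have := fm m.+1 (x m); rewrite wS.
  have := ler_normB (f (x m)) (f (x m) - hump m.+1 (x m)).
  rewrite opprB subrKC -/(w m); lra.
Unshelve. all: by end_near. Qed.

End GlidingHump.

(** If [S] is unbounded, choose x_m in it with norm above m 3^m. The factor 3^m offsets the weight
    of the hump at stage m, so 2 |f (x_m)| > m for a single bounded functional f. *)
Lemma uniform_boundedness (S : set E) :
  (forall f, real_linear f -> (exists c : R, forall x, `|f x| <= c * rnorm x) ->
     exists M : R, forall x, S x -> `|f x| <= M) ->
  exists M : R, forall x, S x -> rnorm x <= M.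
Proof.
move=> weak; apply: contrapT => nS.
have /choice[x xP] : forall m : nat, exists x, S x /\ m%:R * 3 ^+ m < rnorm x.
  move=> m; apply: contrapT => nx; apply: nS; exists (m%:R * 3 ^+ m) => y Sy.
  by rewrite leNgt; apply/negP => yn; apply: nx; exists y.
have /choice[psi psiP] := fun m => real_hahn_banach (x m).
have [|||f [fL fb fx]] := @gliding_hump x psi; try by move=> m; case: (psiP m).
have [|M SM] := weak f fL; first by exists (3 / 2).
pose m := Num.trunc (2 * M); have [Sx xm] := xP m.+1.
have := fx m.+1; apply/negP; rewrite -ltNge.
rewrite exprVn ltr_pdivlMl ?exprn_gt0 //.
apply: le_lt_trans xm; rewrite mulrC ler_wpM2r ?exprn_ge0 //.
apply: (@le_trans _ _ (2 * M)); first by rewrite ler_wpM2l // SM.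
exact/ltW/truncnS_gt.
Qed.

End RealFunctionals.

Lemma linear_bounded_continuousP (R : realType) (k : scalar_kind)
    (E : normedModType (scalars R k)) (phi : {linear E -> (scalars R k)^o}) :
  continuous phi <-> exists C : R, forall x, rabs (phi x) <= C * rnorm x.
Proof.
have pn : seminorm (fun x => rabs (phi x)).
  split=> [x y|a x]; first by rewrite linearD; exact: (@ler_rnormD _ _ (scalars R k)^o).
  by rewrite linearZ /= rabsM.
have en := @seminorm_rnorm R k E.
split=> [phic|[C phiC] x U /nbhs_rnorm[e e0 eU]].
  have /nbhs_rnorm[d d0 dphi] := phic 0 _ (near_rnorm (phi 0) ltr01).
  exists d^-1 => x; rewrite -ler_pdivrMl ?invr_gt0 // invrK -[leRHS]mul1r.
  apply: (seminorm_dominated pn en d0) => y yd.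
  by have := dphi y; rewrite /= linear0 !subr0; exact.
have C1 : 0 < `|C| + 1 by rewrite ltr_wpDl.
apply/nbhs_rnorm; exists (e / (`|C| + 1)); first by rewrite divr_gt0.
move=> y /=; rewrite ltr_pdivlMr // => yx; apply: eU => /=.
rewrite -linearB; apply: le_lt_trans (phiC _) _; apply: le_lt_trans yx.
rewrite mulrC ler_wpM2l ?rnorm_ge0 //.
by rewrite (le_trans (ler_norm C)) // lerDl.
Qed.

Lemma real_part_of_functional (R : realType) (k : scalar_kind)
    (E : normedModType (scalars R k)) (f : E -> R) :
  real_linear f -> (exists c : R, forall x, `|f x| <= c * rnorm x) ->
  exists phi : {linear E -> (scalars R k)^o}, continuous phi /\
    forall x, `|f x| <= rabs (phi x).
Proof.
case: k E f => E f [fD fZ] [c fc].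
  have fL : linear_for *:%R (f : E -> (scalars R RealScalars)^o).
    by move=> a x y; rewrite fD; congr (_ + _); exact: fZ.
  pose phi : {linear E -> (scalars R RealScalars)^o} :=
    HB.pack (f : E -> (scalars R RealScalars)^o) (GRing.isLinear.Build _ _ _ _ _ fL).
  exists phi; split => //.
  by apply/linear_bounded_continuousP; exists c.
pose g x : (scalars R ComplexScalars)^o := (f x +i* - f ('i%C *: x))%C.
have fi x (a b : R) : f ((a +i* b)%C *: x) = a * f x + b * f ('i%C *: x).
  rewrite -fZ -fZ -fD scalerA -scalerDl; congr (f (_ *: _)).
  by rewrite /of_real /=; simpc.
have gL : linear_for *:%R g.
  move=> [a b] x y; rewrite /g fD scalerDr fD (fi x a b) scalerA.
  have -> : 'i%C * (a +i* b)%C = ((- b) +i* a)%C :> R[i] by simpc.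
  rewrite (fi x (- b) a).
  rewrite -[X in _ = X + _]/((a +i* b) * (f x +i* - f ('i *: x)))%C; simpc.
  apply/eqP; rewrite eq_complex /=.
  by apply/andP; split; apply/eqP; ring.
pose phi : {linear E -> (scalars R ComplexScalars)^o} :=
  HB.pack g (GRing.isLinear.Build _ _ _ _ _ gL).
have rabsE (a b : R) : rabs ((a +i* b)%C : scalars R ComplexScalars) =
    Num.sqrt (a ^+ 2 + b ^+ 2).
  by transitivity (complex.Re `|(a +i* b)%C|); rewrite // normc_def.
have phiE x : rabs (phi x) = Num.sqrt (f x ^+ 2 + (- f ('i%C *: x)) ^+ 2).
  exact: rabsE.
exists phi; split.
  apply/linear_bounded_continuousP; exists (c + c) => x.
  have fix_ : `|f ('i%C *: x)| <= c * rnorm x.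
    apply: le_trans (fc _) _; rewrite rnormZ (rabsE 0 1) expr0n expr1n add0r sqrtr1.
    by rewrite mul1r.
  rewrite phiE sqrrN mulrDl.
  apply: le_trans (lerD (fc x) fix_).
  rewrite -[leRHS]ger0_norm ?addr_ge0 // -sqrtr_sqr ler_sqrt ?sqr_ge0 //.
  rewrite sqrrD !real_normK ?num_real // -addrA lerD2l lerDr.
  by rewrite mulrn_wge0 // mulr_ge0.
move=> x; rewrite phiE -sqrtr_sqr ler_sqrt ?addr_ge0 ?sqr_ge0 //.
by rewrite lerDl sqr_ge0.
Qed.

(** * Lipschitz functions *)

Section MetricSpaces.
Context (R : realType) (Om : metricType R).
Implicit Types (x y o : Om) (C : set Om).

Lemma mdist_continuous : continuous (fun z : Om * Om => mdist z.1 z.2 : R^o).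
Proof.
move=> [x y] U /nbhs_ballP[e /= e0 eU].
have e2 : 0 < e / 2 by rewrite divr_gt0.
exists (ball x (e / 2), ball y (e / 2)) => [|[x' y'] [/=]].
  by split; exact: nbhsx_ballx.
rewrite !ballEmdist /= => xx yy; apply: eU; rewrite /ball /= ltr_norml.
have := metric_triangle x x' y; have := metric_triangle x' y' y.
have := metric_triangle x' x y'; have := metric_triangle x y y'.
rewrite (metric_sym x' x) (metric_sym y' y); lra.
Qed.

(** Without a finite net, the points of [C] at distance at least [d] from a finite list generate a
    proper filter; adding a cluster point to the list is contradictory. *)
Lemma compact_totally_bounded C (d : R) : compact C -> 0 < d ->
  exists s : seq Om, forall x, C x -> exists2 y, y \in s & mdist x y < d.
Proof.
move=> cC d0; apply: contrapT => nos.
pose F := filter_from setT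
  (fun s : seq Om => C `&` [set x | forall y, y \in s -> d <= mdist x y]).
have FF : ProperFilter F.
  apply: filter_from_proper.
    apply: filter_from_filter; first by exists [::].
    move=> s t _ _; exists (s ++ t) => // x [Cx xst].
    by split; split => // y yst; apply: xst; rewrite mem_cat yst ?orbT.
  move=> s _; apply: contrapT => Cs; apply: nos; exists s => x Cx.
  apply: contrapT => xs; apply: Cs; exists x; split => // y ys.
  by rewrite leNgt; apply/negP => xy; apply: xs; exists y.
have [|x [Cx clx]] := cC F FF; first by exists [::] => // x [].
have Fx : F [set y | d <= mdist y x].
  by exists [:: x] => // y [_]; apply; rewrite mem_head.
have [y [/= dyx]] := clx _ _ Fx (nbhsx_ballx x d d0).
by rewrite ballEmdist /= metric_sym ltNge dyx.
Qed.

Lemma compact_mdist_le C o : compact C ->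
  exists2 D : R, 0 <= D & forall x, C x -> mdist x o <= D.
Proof.
move=> cC; have [s sC] := compact_totally_bounded cC (@ltr01 R).
exists (1 + \sum_(y <- s) mdist y o).
  by rewrite addr_ge0 // sumr_ge0 // => y _; exact: mdist_ge0.
move=> x /sC[y ys xy]; apply: le_trans (metric_triangle x y o) _.
apply: lerD; first exact: ltW.
rewrite (big_rem y) //= lerDl sumr_ge0 // => z _; exact: mdist_ge0.
Qed.

Lemma compact_pairs_mdist_ge (S : set (Om * Om)) : compact_pairs Om S ->
  exists2 d : R, 0 < d & forall z, S z -> d <= mdist z.1 z.2.
Proof.
move=> [cS Soff]; have [->|/set0P S0] := eqVneq S set0; first by exists 1.
have mc : {within S, continuous (fun z : Om * Om => mdist z.1 z.2 : R^o)}.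
  exact/continuous_subspaceT/mdist_continuous.
have [z /set_mem Sz zmin] := compact_EVT_min S0 cS mc.
exists (mdist z.1 z.2) => [|w Sw]; last by apply: zmin; exact: mem_set.
by rewrite mdist_gt0; apply/eqP/Soff.
Qed.

Lemma finite_compact_pairs : finite_pairs Om `<=` compact_pairs Om.
Proof. by move=> S [fS Soff]; split => //; exact: finite_compact. Qed.

Lemma singleton_finite_pairs z : off_diagonal z -> finite_pairs Om [set z].
Proof. by move=> zoff; split => [|_ ->]; [exact: finite_set1|]. Qed.

End MetricSpaces.

Lemma entourage_rnorm (R : realType) (k : scalar_kind)
    (E : normedModType (scalars R k)) (A : set (E * E)) :
  entourage A <-> exists2 e : R, 0 < e &
    [set z | rnorm (z.2 - z.1) < e] `<=` A.
Proof.
rewrite -entourage_ballE; split=> [[e /= e0 eA]|[e e0 eA]].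
  exists (real_part e).
    by rewrite -(@ltr_of_real _ k) of_real0 -ge0_of_real // ltW.
  move=> z; rewrite /= -(@ltr_of_real _ k) -norm_rnorm -ge0_of_real; last exact: ltW.
  by move=> ze; apply: eA; rewrite /= -ball_normE /= distrC.
exists (of_real k e); first by rewrite /= -of_real0 ltr_of_real.
move=> z; rewrite /= -ball_normE /= distrC norm_rnorm ltr_of_real; exact: eA.
Qed.

(** * Seminorms and topologies on the space of Lipschitz functions *)

Section Lipschitz.
Context (R : realType) (k : scalar_kind) (Om : metricType R) (o : Om).
Variable E : normedModType (scalars R k).
Local Notation K := (scalars R k).
Local Notation L := (Lip0 o E).
Local Notation n := (lip_norm o E).
Implicit Types (f g : L) (S : set (Om * Om)) (x y : Om) (C : set Om).

Lemma Lip0P f : lip0 o E f.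
Proof. by apply: set_mem; exact: (valP f). Qed.

Lemma Lip0_base f : f o = 0. Proof. by case: (Lip0P f). Qed.

Lemma Lip0D f g x : (f + g) x = f x + g x. Proof. by []. Qed.

Lemma Lip0Z a f x : (a *: f) x = a *: f x. Proof. by []. Qed.

Lemma Lip0N f x : (- f) x = - f x.
Proof. by rewrite -scaleN1r Lip0Z scaleN1r. Qed.

Lemma Lip0B f g x : (f - g) x = f x - g x.
Proof. by rewrite Lip0D Lip0N. Qed.

Lemma slope_ge S f z : S `<=` @off_diagonal R Om -> S z ->
  rnorm (f z.1 - f z.2) / mdist z.1 z.2 <= slope_seminorm S f.
Proof.
move=> Soff Sz; apply: ub_le_sup; last by exists z.
have [_ [M fM]] := Lip0P f; exists M => _ [w Sw <-].
by apply: fM; exists w => //; exact: Soff.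
Qed.

Lemma slope_le S f (c : R) : 0 <= c ->
  (forall z, S z -> rnorm (f z.1 - f z.2) / mdist z.1 z.2 <= c) ->
  slope_seminorm S f <= c.
Proof.
move=> c0 fc; have [S0|/set0P[z Sz]] := eqVneq S set0.
  by rewrite /slope_seminorm /slopes S0 image_set0 sup0.
by apply: ge_sup; [exists (rnorm (f z.1 - f z.2) / mdist z.1 z.2), z|
  move=> _ [w Sw <-]; exact: fc].
Qed.

Let slope_seminorm_ge0 S f : S `<=` @off_diagonal R Om -> 0 <= slope_seminorm S f.
Proof.
move=> Soff; have [S0|/set0P[z Sz]] := eqVneq S set0.
  by rewrite /slope_seminorm /slopes S0 image_set0 sup0.
by apply: le_trans (slope_ge f Soff Sz); rewrite divr_ge0 ?rnorm_ge0 ?mdist_ge0.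
Qed.

Lemma seminorm_slope S : S `<=` @off_diagonal R Om ->
  seminorm (@slope_seminorm R k Om o E S).
Proof.
move=> Soff; apply: seminormP => [f|f g|a f].
- exact: slope_seminorm_ge0.
- apply: slope_le => [|z Sz]; first by rewrite addr_ge0 ?slope_seminorm_ge0.
  apply: le_trans (lerD (slope_ge f Soff Sz) (slope_ge g Soff Sz)).
  rewrite -mulrDl ler_wpM2r ?invr_ge0 ?mdist_ge0 //.
  by rewrite !Lip0D opprD addrACA ler_rnormD.
- apply: slope_le => [|z Sz]; first by rewrite mulr_ge0 ?slope_seminorm_ge0 ?rabs_ge0.
  rewrite !Lip0Z -scalerBr rnormZ -mulrA ler_wpM2l ?rabs_ge0 //.
  exact: slope_ge.
Qed.

Lemma slope_seminorm_le S S' f : S' `<=` @off_diagonal R Om -> S `<=` S' ->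
  slope_seminorm S f <= slope_seminorm S' f.
Proof.
move=> S'off SS'; apply: slope_le; first exact: slope_seminorm_ge0.
by move=> z /SS' S'z; exact: slope_ge.
Qed.

Lemma seminorm_lip : seminorm n. Proof. exact: seminorm_slope. Qed.

Lemma lip_normP f x y : rnorm (f x - f y) <= n f * mdist x y.
Proof.
have [->|xy] := eqVneq x y; first by rewrite subrr rnorm0 mdistxx mulr0.
rewrite -ler_pdivrMr ?mdist_gt0 //.
by apply: (slope_ge f (z := (x, y)) (fun _ h => h)); exact/eqP.
Qed.

Lemma lip_norm_le f (c : R) : 0 <= c ->
  (forall x y, rnorm (f x - f y) <= c * mdist x y) -> n f <= c.
Proof.
move=> c0 fc; apply: slope_le => // z /eqP zoff.
by rewrite ler_pdivrMr ?mdist_gt0.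
Qed.

Lemma Lip0_le f x : rnorm (f x) <= n f * mdist x o.
Proof. by have := lip_normP f x o; rewrite Lip0_base subr0. Qed.

Lemma is_norm_lip : is_norm n.
Proof.
split; first exact: seminorm_lip.
move=> f f0; apply/val_inj/funext => x; apply: rnorm_eq0.
apply/eqP; rewrite eq_le rnorm_ge0 andbT.
by apply: le_trans (Lip0_le f x) _; rewrite f0 mul0r.
Qed.

Lemma Lip0_intro (f : Om -> E) (c : R) : f o = 0 ->
  (forall x y, rnorm (f x - f y) <= c * mdist x y) -> exists g : L, g =1 f.
Proof.
move=> f0 fc; have lf : f \in @lip0_pred R k Om o E.
  apply/mem_set; split => //; exists c => _ [z /eqP zoff <-].
  by rewrite ler_pdivrMr ?mdist_gt0.
by exists (MkLip0 lf).
Qed.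

(** Both directions pass through convergence of filters uniformly on compact sets: the filter
    generated by the basic sets is shown to converge to [f], and conversely the neighbourhood filter
    of [f] is tested on [C]. *)
Lemma nbhs_tau_co f U : nbhs_in (tau_co o E) f U <-> exists2 C, compact C &
  exists2 e : R, 0 < e & [set g : L | forall x, C x -> rnorm (g x - f x) < e] `<=` U.
Proof.
split=> [|[C cC [e e0 eU]]].
  case=> _ [[V oV <-] Vf VU].
  pose F := filter_from [set Ce : set Om * R | compact Ce.1 /\ 0 < Ce.2]
    (fun Ce => [set g : L | forall x, Ce.1 x -> rnorm (g x - f x) < Ce.2]).
  have FF : Filter F.
    apply: filter_from_filter; first by exists (set0, 1); split => //; exact: compact0.
    move=> [C d] [D e] [/= cC d0] [/= cD e0]; exists (C `|` D, Num.min d e).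
      by split; [exact: compactU|rewrite lt_min d0].
    move=> g /= gCD; split=> x xC.
      by have := gCD x (or_introl xC); rewrite lt_min => /andP[].
    by have := gCD x (or_intror xC); rewrite lt_min => /andP[].
  have : {family compact, (fun g : L => lip0_fun g) @ F --> lip0_fun f}.
    apply/fam_cvgP => C cC P /uniform_nbhs[A [/entourage_rnorm[e e0 eA] AP]].
    exists (C, e) => // g gf; apply: AP => x Cx; apply: eA => /=.
    exact: gf.
  move=> /(_ V)[|[C e] [/= cC e0] CeV].
    by apply: open_nbhs_nbhs; split.
  by exists C => //; exists e => // g gf; apply: VU; exact: CeV.
apply: filterS eU _.
have fam : {family compact, nbhs (lip0_fun f : {family compact, Om -> E}) --> lip0_fun f}.
  by [].
have /fam_cvgP/(_ C cC) uC := fam.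
have fV : nbhs (lip0_fun f : {family compact, Om -> E})
    [set h : Om -> E | forall x, C x -> rnorm (h x - f x) < e].
  apply: uC; apply/uniform_nbhs; exists [set z | rnorm (z.2 - z.1) < e].
  by split => //; apply/entourage_rnorm; exists e.
exact: (@initial_continuous L {family compact, Om -> E} (fun f : L => lip0_fun f) f _ fV).
Qed.

Definition sup_seminorm C f : R := sup [set rnorm (f x) | x in C].

Lemma sup_seminorm_ge C f x : compact C -> C x -> rnorm (f x) <= sup_seminorm C f.
Proof.
move=> cC Cx; apply: ub_le_sup; last by exists x.
have [D D0 CD] := compact_mdist_le o cC; exists (n f * D) => _ [y Cy <-].
by apply: le_trans (Lip0_le f y) _; rewrite ler_wpM2l ?CD ?(seminorm_ge0 _ seminorm_lip).
Qed.

Lemma sup_seminorm_le C f (c : R) : 0 <= c ->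
  (forall x, C x -> rnorm (f x) <= c) -> sup_seminorm C f <= c.
Proof.
move=> c0 fc; have [C0|/set0P[x Cx]] := eqVneq C set0.
  by rewrite /sup_seminorm C0 image_set0 sup0.
by apply: ge_sup; [exists (rnorm (f x)), x|move=> _ [y Cy <-]; exact: fc].
Qed.

Lemma continuous_sup_seminorm C : compact C ->
  continuous_seminorm (tau_co o E) (sup_seminorm C).
Proof.
move=> cC.
have ge0 f : 0 <= sup_seminorm C f.
  have [C0|/set0P[x Cx]] := eqVneq C set0; last first.
    by apply: le_trans (sup_seminorm_ge f cC Cx); exact: rnorm_ge0.
  by rewrite /sup_seminorm C0 image_set0 sup0.
split.
  apply: seminormP => // [f g|a f]; apply: sup_seminorm_le.
  - by rewrite addr_ge0.
  - move=> x Cx; apply: le_trans (ler_rnormD _ _) _.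
    by apply: lerD; exact: sup_seminorm_ge.
  - by rewrite mulr_ge0 ?rabs_ge0.
  - by move=> x Cx; rewrite Lip0Z rnormZ ler_wpM2l ?rabs_ge0 ?sup_seminorm_ge.
move=> e e0; apply/nbhs_tau_co; exists C => //.
have e2 : 0 < e / 2 by rewrite divr_gt0.
exists (e / 2) => // g gf; apply: (@le_lt_trans _ _ (e / 2)); last first.
  by rewrite ltr_pdivrMr // ltr_pMr // ltrDl.
by apply: sup_seminorm_le => [|x /gf /ltW]; [exact: ltW|rewrite subr0].
Qed.

Lemma by_seminorms_co : by_seminorms (tau_co o E).
Proof.
move=> f U; split=> [/nbhs_tau_co[C cC [e e0 eU]]|].
  exists (fun g => e^-1 * sup_seminorm C g).
    apply: continuous_seminorm_scale; first by rewrite invr_ge0 ltW.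
    exact: continuous_sup_seminorm.
  move=> g /=; rewrite mulrC ltr_pdivrMr // mul1r => gf; apply: eU => x Cx.
  by rewrite -Lip0B; apply: le_lt_trans gf; exact: sup_seminorm_ge.
move=> [p [_ /(_ 1 ltr01)/nbhs_tau_co[C cC [e e0 eU]]] pU].
apply/nbhs_tau_co; exists C => //; exists e => // g gf; apply: pU.
by apply: eU => x Cx; rewrite subr0 Lip0B; exact: gf.
Qed.

Lemma co_seminorm_cofinal (K_ : nat -> set Om) :
  (forall m, compact (K_ m)) -> (forall C, compact C -> exists m, C `<=` K_ m) ->
  forall q, continuous_seminorm (tau_co o E) q ->
  exists i, exists c : R, forall f, q f <= c * sup_seminorm (K_ i) f.
Proof.
move=> cK Kcof q [qn /(_ 1 ltr01)/nbhs_tau_co[C cC [e e0 eq]]].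
have [i CK] := Kcof C cC; exists i, e^-1 => f.
rewrite -ler_pdivrMl ?invr_gt0 // invrK -[leRHS]mul1r.
apply: (seminorm_dominated qn (proj1 (continuous_sup_seminorm (cK i))) e0) => g ge.
apply: eq => x /CK Kx; rewrite subr0; apply: le_lt_trans ge.
exact: sup_seminorm_ge.
Qed.

Lemma co_coarser_norm : coarser (tau_co o E) (norm_topology n).
Proof.
apply/coarserP => f U /nbhs_tau_co[C cC [e e0 eU]].
have [D D0 CD] := compact_mdist_le o cC.
have D1 : 0 < D + 1 by rewrite ltr_wpDl.
have nn : forall q, [set n] q -> seminorm q by move=> _ ->; exact: seminorm_lip.
apply/(nbhs_generated_by nn); exists [set n]; first by split => //; exact: finite_set1.
exists (e / (D + 1)); first by rewrite divr_gt0.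
move=> g /(_ n erefl) ng; apply: eU => x Cx; rewrite -Lip0B.
apply: le_lt_trans (Lip0_le _ x) _; move: ng; rewrite ltr_pdivlMr //.
apply: le_lt_trans; rewrite ler_wpM2l ?(seminorm_ge0 _ seminorm_lip) //.
by apply: le_trans (CD x Cx) _; rewrite lerDl.
Qed.

(** A compact set off the diagonal keeps a distance [d] > 0 from it, so its slopes are at most 2 / d
    times the supremum over the union of its two projections. *)
Lemma continuous_slope_co S : compact_pairs Om S ->
  continuous_seminorm (tau_co o E) (@slope_seminorm R k Om o E S).
Proof.
move=> cpS; have [cS Soff] := cpS; have [d d0 Sd] := compact_pairs_mdist_ge cpS.
pose C := (fst @` S) `|` (snd @` S).
have cC : compact C.
  apply: compactU; apply: continuous_compact => //; apply: continuous_subspaceT.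
    by move=> z; exact: cvg_fst.
  by move=> z; exact: cvg_snd.
have Cn f : 0 <= sup_seminorm C f.
  exact: seminorm_ge0 (proj1 (continuous_sup_seminorm cC)).
have d2 : 0 <= 2 / d by rewrite divr_ge0 // ltW.
apply: continuous_seminorm_le
  (continuous_seminorm_scale d2 (continuous_sup_seminorm cC)) _.
  exact: seminorm_slope.
move=> f; apply: slope_le => [|z Sz]; first by rewrite mulr_ge0.
have dz := lt_le_trans d0 (Sd z Sz).
rewrite ler_pdivrMr // (@le_trans _ _ (2 * sup_seminorm C f)) //.
  apply: le_trans (ler_rnormD _ _) _; rewrite rnormN mulr_natl mulr2n.
  by apply: lerD; apply: sup_seminorm_ge => //; [left|right]; exists z.
rewrite [leRHS](_ : _ = 2 * sup_seminorm C f * (mdist z.1 z.2 / d)); last by ring.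
by rewrite ler_peMr ?mulr_ge0 // ler_pdivlMr // mul1r Sd.
Qed.

End Lipschitz.

(** * Slope topologies, and the Saks space properties of Lipschitz functions *)

Section PairTopologies.
Context (R : realType) (k : scalar_kind) (Om : metricType R) (o : Om).
Variable E : normedModType (scalars R k).
Local Notation K := (scalars R k).
Local Notation L := (Lip0 o E).
Local Notation n := (lip_norm o E).
Local Notation co := (tau_co o E).
Implicit Types (f g : L) (S : set (Om * Om)) (x y : Om) (C : set Om).

(* Norm-bounded functions are equi-Lipschitz, so smallness on a compact set
   follows from smallness on a finite net. *)
Lemma equi_lipschitz_net C (M e : R) : compact C -> 0 < e ->
  exists s : seq Om, forall f, n f <= M -> (forall y, y \in s -> rnorm (f y) < e / 2) ->
    forall x, C x -> rnorm (f x) < e.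
Proof.
move=> cC e0; have N0 : 0 < `|M| + 1 by rewrite ltr_wpDl.
have e2 : 0 < e / 2 by rewrite divr_gt0.
have [s Cs] := compact_totally_bounded cC (divr_gt0 e2 N0).
exists s => f fM sf x /Cs[y ys xy].
have fxy : rnorm (f x - f y) <= e / 2.
  apply: le_trans (lip_normP _ _ _) _.
  apply: (@le_trans _ _ ((`|M| + 1) * (e / 2 / (`|M| + 1)))); last first.
    by rewrite mulrC divfK // gt_eqF.
  apply: ler_pM; [exact: seminorm_ge0 (seminorm_lip o E)|exact: mdist_ge0| |exact: ltW].
  by apply: le_trans fM _; rewrite (le_trans (ler_norm M)) // lerDl.
rewrite -[f x](subrK (f y)); apply: le_lt_trans (ler_rnormD _ _) _.
by rewrite (splitr e) ler_ltD // sf.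
Qed.

Section Family.
Variable SS : set (set (Om * Om)).
Hypotheses (SSc : SS `<=` compact_pairs Om) (SSf : finite_pairs Om `<=` SS).
Local Notation tau := (tau_fam o E SS).

Let Gn (q : L -> R) : [set @slope_seminorm R k Om o E S | S in SS] q -> seminorm q.
Proof. by move=> [S /SSc[_ Soff] <-]; exact: seminorm_slope. Qed.

Lemma by_seminorms_fam : by_seminorms tau.
Proof. exact: by_seminorms_generated_by. Qed.

Lemma continuous_slope_fam S : SS S ->
  continuous_seminorm tau (@slope_seminorm R k Om o E S).
Proof. by move=> SSS; apply: continuous_seminorm_generated_by => //; exists S. Qed.

Lemma fam_coarser_co : coarser tau co.
Proof.
apply: (generated_by_coarser Gn); first exact: by_seminorms_co.
by move=> _ [S /SSc cS <-]; exact: continuous_slope_co.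
Qed.

Lemma fam_coarser_norm : coarser tau (norm_topology n).
Proof. by move=> U /fam_coarser_co; exact: co_coarser_norm. Qed.

Lemma coincide_co_fam (B : set L) : norm_bounded n B -> coincide_on B co tau.
Proof.
move=> [M BM]; apply/coincide_onP; split=> f U Bf; last first.
  by exists U; [move/coarserP : fam_coarser_co; exact|exact: subIsetr].
move=> /nbhs_tau_co[C cC [e e0 eU]].
have [s sC] := equi_lipschitz_net (2 * M) cC e0.
pose D := \sum_(y <- s) mdist y o.
have D0 : 0 <= D by apply: sumr_ge0 => y _; exact: mdist_ge0.
have D1 : 0 < D + 1 by rewrite ltr_wpDl.
have sD y : y \in s -> mdist y o <= D + 1.
  move=> ys; rewrite /D (big_rem y) //= -addrA lerDl addr_ge0 //.
  by apply: sumr_ge0 => z _; exact: mdist_ge0.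
(* The base point is removed from the net, as (o, o) lies on the diagonal; all functions vanish
   there. *)
pose S : set (Om * Om) := [set z | z \in [seq (y, o) | y <- s & y != o]].
have SSS : SS S.
  apply: SSf; split; first exact: finite_seq.
  move=> z /mapP[y]; rewrite mem_filter => /andP[/eqP yo _] -> //.
have Soff : S `<=` @off_diagonal R Om by have [] := SSc SSS.
exists [set g | slope_seminorm S (g - f) < e / 2 / (D + 1)].
  apply: (nbhs_seminorm by_seminorms_fam); last by rewrite !divr_gt0.
  exact: continuous_slope_fam.
move=> g [Bg /= gf]; apply: eU => x Cx; rewrite -Lip0B; apply: sC Cx.
  apply: le_trans (seminormD _ _ (seminorm_lip o E)) _.
  rewrite (seminormN _ (seminorm_lip o E)) mulr_natl mulr2n.
  by apply: lerD; exact: BM.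
move=> y ys; have [->|yo] := eqVneq y o; first by rewrite Lip0_base rnorm0 divr_gt0.
have : rnorm ((g - f) y - (g - f) o) / mdist y o <= slope_seminorm S (g - f).
  apply: (slope_ge (g - f) (z := (y, o)) Soff); apply/mapP; exists y => //.
  by rewrite mem_filter yo.
rewrite Lip0_base subr0 ler_pdivrMr ?mdist_gt0 // => /le_lt_trans; apply.
apply: (@le_lt_trans _ _ (slope_seminorm S (g - f) * (D + 1))).
  by rewrite ler_wpM2l ?sD // (seminorm_ge0 _ (seminorm_slope o E Soff)).
by rewrite -ltr_pdivlMr.
Qed.

End Family.

Lemma norming_lip (tau : Topological L) :
  (forall z, off_diagonal z ->
     continuous_seminorm tau (@slope_seminorm R k Om o E [set z])) ->
  norming n tau.
Proof.
(* There are no slopes when [Om] is a single point. The zero seminorm handles negative [c], and for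
   c >= 0 the assumption c < n f provides a slope. *)
move=> tz f c cf; have [c0|c0] := ltP c 0.
  exists (fun=> 0); split => //; first exact: continuous_seminorm0.
  by move=> g; exact: seminorm_ge0 (seminorm_lip o E).
have [_ [z zoff <-] cz] : exists2 r, slopes f (@off_diagonal R Om) r & c < r.
  apply: (sup_gt _ cf); apply/set0P/eqP => s0.
  by move: cf; rewrite /lip_norm /slope_seminorm s0 sup0 ltNge c0.
exists (@slope_seminorm R k Om o E [set z]); split; first exact: tz.
  by move=> g; apply: slope_seminorm_le => // _ ->.
by apply: lt_le_trans cz _; apply: slope_ge => // _ ->.
Qed.

Lemma norming_co : norming n co.
Proof.
apply: norming_lip => z zoff.
exact/continuous_slope_co/finite_compact_pairs/singleton_finite_pairs.
Qed.

Lemma saks_space_co : saks_space n co.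
Proof.
apply: saks_space_norming; [exact: is_norm_lip|exact: by_seminorms_co|
  exact: co_coarser_norm|exact: norming_co].
Qed.

Lemma saks_space_fam (SS : set (set (Om * Om))) : SS `<=` compact_pairs Om ->
  finite_pairs Om `<=` SS -> saks_space n (tau_fam o E SS).
Proof.
move=> SSc SSf; apply: saks_space_norming.
- exact: is_norm_lip.
- exact: by_seminorms_fam.
- exact: fam_coarser_norm.
- by apply: norming_lip => z /singleton_finite_pairs/SSf; exact: continuous_slope_fam.
Qed.

Lemma mixed_co_fam (SS : set (set (Om * Om))) : SS `<=` compact_pairs Om ->
  finite_pairs Om `<=` SS ->
  opens (mixed_topology n co) = opens (mixed_topology n (tau_fam o E SS)).
Proof.
move=> SSc SSf; apply/esym/mixed_topology_eq.
- exact: seminorm_lip.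
- exact: by_seminorms_fam.
- exact: by_seminorms_co.
- exact: fam_coarser_co.
- exact: co_coarser_norm.
- by move=> B; exact: coincide_co_fam.
Qed.

Lemma C_sequential_co : hemicompact Om -> saks_C_sequential n co.
Proof.
move=> [K_ cK Kcof]; apply: (@mixed_C_sequential _ _ _ n co (seminorm_lip o E)
  (@by_seminorms_co _ _ _ o E) (@co_coarser_norm _ _ _ o E)
  (fun m => @sup_seminorm R k Om o E (K_ m))).
  by move=> m; exact: continuous_sup_seminorm.
exact: co_seminorm_cofinal.
Qed.

(** The filter need not contain a norm-bounded set, so [h] does not inherit a Lipschitz constant
    directly. If [h] is not Lipschitz, pairs z_m with slopes above 2 (m + 1)^2 give a mixed
    seminorm, the supremum of the slopes at z_m divided by m + 1. Fix [g] in a member of [F] that is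
    small for it, and m with n g <= m + 1. At z_m the slopes of g and, in the limit, of g - h are at
    most m + 1, so that of [h] is at most 2 (m + 1), a contradiction. *)
Lemma pointwise_limit_Lip0 (F : set_system (top (mixed_topology n co))) (h : Om -> E) :
  ProperFilter F -> cauchy_filter (mixed_topology n co) F ->
  (forall x (e : R), 0 < e -> F [set g : L | rnorm (g x - h x) < e]) ->
  exists f : L, f =1 h.
Proof.
move=> FF Fc Fh.
have h0 : h o = 0.
  apply: rnorm_eq0; apply/eqP; rewrite eq_le rnorm_ge0 andbT leNgt.
  apply/negP => /(Fh o)/filter_ex[g /=].
  by rewrite Lip0_base sub0r rnormN ltxx.
suff [c hc] : exists c : R, forall x y, rnorm (h x - h y) <= c * mdist x y.
  exact: Lip0_intro h0 hc.
apply: contrapT => nc.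
have /choice[z zP] : forall m : nat, exists z : Om * Om,
    2 * m.+1%:R ^+ 2 * mdist z.1 z.2 < rnorm (h z.1 - h z.2).
  move=> m; apply: contrapT => nz; apply: nc; exists (2 * m.+1%:R ^+ 2) => x y.
  by rewrite leNgt; apply/negP => xy; apply: nz; exists (x, y).
have zoff m : off_diagonal (z m).
  move=> zz; have := zP m; rewrite zz subrr rnorm0 mdistxx mulr0.
  by rewrite ltxx.
pose q m := @slope_seminorm R k Om o E [set z m].
have qt m : continuous_seminorm co (q m).
  by apply/continuous_slope_co/finite_compact_pairs/singleton_finite_pairs.
have qn m f : q m f <= n f by apply: slope_seminorm_le => // _ ->.
pose a : nat -> R := fun m => m.+1%:R^-1.
have a0 m : 0 <= a m by rewrite invr_ge0.
have acvg : a @ \oo --> (0 : R^o) by exact: cvg_harmonic.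
have pm := mixed_seminorm_weighted_sup qt qn a0 acvg.
have /(continuous_seminorm_mixed (seminorm_lip o E) (@by_seminorms_co _ _ _ o E)
  (@co_coarser_norm _ _ _ o E))[_ /(_ 1 ltr01)/Fc[A FA Ap]] := pm.
have [g Ag] := filter_ex FA.
pose m := Num.trunc (n g).
have d0 : 0 < mdist (z m).1 (z m).2 by rewrite mdist_gt0; apply/eqP/zoff.
have gh (f : L) : A f -> rnorm ((g (z m).1 - f (z m).1) - (g (z m).2 - f (z m).2)) <=
    m.+1%:R * mdist (z m).1 (z m).2.
  move=> Af; have /ltW := Ap g f Ag Af.
  move=> /(le_trans (weighted_sup_ge qt qn a0 acvg m (g - f))).
  rewrite ler_pdivrMr // mul1r -ler_pdivrMr //; apply: le_trans.
  by rewrite -!Lip0B; apply: slope_ge => // _ ->.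
have := zP m; apply/negP; rewrite -leNgt; apply/ler_addgt0Pl => e e0.
have e2 : 0 < e / 2 by rewrite divr_gt0.
have [f [[/= f1 f2] Af]] :=
  filter_ex (filterI (filterI (Fh (z m).1 _ e2) (Fh (z m).2 _ e2)) FA).
have gm : n g <= m.+1%:R by apply/ltW/truncnS_gt.
have := gh f Af; have := lip_normP g (z m).1 (z m).2.
move: f1 f2; set u := (z m).1; set v := (z m).2; move=> f1 f2 gl gf.
have huv : rnorm (h u - h v) <= rnorm (f u - h u) + rnorm (f v - h v) +
    (rnorm (g u - f u - (g v - f v)) + rnorm (g u - g v)).
  have gfE : g u - f u - (g v - f v) = (g u - g v) - (f u - f v).
    by rewrite !opprD !opprK addrACA.
  apply: le_trans (ler_rnormB _ (f u) _) _; rewrite (rnormB (h u)) -addrA lerD2l.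
  apply: le_trans (ler_rnormB _ (f v) _) _; rewrite [leLHS]addrC lerD2l gfE.
  have := ler_rnormD (f u - f v - (g u - g v)) (g u - g v).
  by rewrite subrK (rnormB (f u - f v)).
apply: le_trans huv _.
apply: (@le_trans _ _ (e / 2 + e / 2 + (m.+1%:R * mdist u v + m.+1%:R * mdist u v))).
  apply: lerD; first by apply: lerD; exact: ltW.
  by apply: lerD => //; apply: le_trans gl _; rewrite ler_wpM2r ?mdist_ge0.
rewrite -splitr lerD2l -mulrDl ler_wpM2r ?mdist_ge0 // -mulr2n -[leLHS]mulr_natl.
by rewrite ler_wpM2l // expr2 ler_peMr // ler1n.
Qed.

Lemma saks_complete_co : banach E -> saks_complete n co.
Proof.
move=> bE F FF Fc.
have small C (e : R) : compact C -> 0 < e -> exists2 A, F A &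
    forall g h, A g -> A h -> forall x, C x -> rnorm (g x - h x) < e.
  move=> cC e0; have [|A FA Ae] := Fc [set g | sup_seminorm C g < e].
    have := mixed_seminorm_continuous n (@continuous_sup_seminorm _ _ _ o E _ cC).
    move/(continuous_seminorm_mixed (seminorm_lip o E) (@by_seminorms_co _ _ _ o E)
      (@co_coarser_norm _ _ _ o E)) => [_]; exact.
  exists A => // g h Ag Ah x Cx; rewrite -Lip0B.
  by apply: le_lt_trans (Ae g h Ag Ah); exact: sup_seminorm_ge.
have /choice[h hF] : forall x, exists l : E, forall e : R, 0 < e ->
    F [set g : L | rnorm (g x - l) < e].
  move=> x; have /bE : cauchy ((fun g : L => g x) @ F).
    move=> B /entourage_rnorm[e e0 eB].
    have [A FA Ae] := small [set x] e (@compact_set1 _ _) e0.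
    pose Ax := [set (g : L) x | g in A].
    have FAx : F [set g : L | Ax (g x)] by apply: filterS FA => g Ag; exists g.
    exists (Ax, Ax) => //.
    by move=> [_ _] [/= [g Ag <-] [g' Ag' <-]]; apply: eB; exact: Ae.
  move=> /cvg_ex[l Fl]; exists l => e e0.
  exact: (Fl _ (near_rnorm l e0)).
have [f fh] := pointwise_limit_Lip0 FF Fc hF.
exists f; apply: (mixed_cvg (seminorm_lip o E) (@by_seminorms_co _ _ _ o E)
  (@co_coarser_norm _ _ _ o E)) => // r [_ /(_ 1 ltr01)/nbhs_tau_co[C cC [e e0 er]]].
have e2 : 0 < e / 2 by rewrite divr_gt0.
have [A FA Ae] := small C (e / 2) cC e2.
apply: filterS (FA) => g Ag; apply: er => x Cx; rewrite subr0 Lip0B.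
have [g' [/= g'x Ag']] := filter_ex (filterI (hF x _ e2) FA).
apply: le_lt_trans (ler_rnormB _ (g' x) _) _; rewrite (splitr e) fh.
by apply: ltrD => //; exact: Ae.
Qed.

Lemma lip0_weakE : lip0 o E = lip0_weak o E.
Proof.
apply/seteqP; split=> f.
  move=> [f0 [M fM]] phi /linear_bounded_continuousP[C phiC]; split.
    by rewrite /= f0 linear0.
  exists (`|C| * M) => _ [z zoff <-].
  have zM : rnorm (f z.1 - f z.2) / mdist z.1 z.2 <= M by apply: fM; exists z.
  apply: le_trans (ler_wpM2l (normr_ge0 C) zM).
  rewrite mulrA ler_wpM2r ?invr_ge0 ?mdist_ge0 //= -linearB rnorm_scalars.
  by apply: le_trans (phiC _) _; rewrite ler_wpM2r ?rnorm_ge0 ?ler_norm.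
move=> fw; split.
  (* A functional norming [f o] is dominated by a scalar one, which vanishes at [f o] by the weak
     hypothesis. *)
  have [g [gL gn gf]] := real_hahn_banach (f o).
  have [|phi [phic gphi]] := real_part_of_functional gL.
    by exists 1 => x; rewrite mul1r.
  have [phi0 _] := fw phi phic.
  apply: rnorm_eq0; apply/eqP; rewrite eq_le rnorm_ge0 andbT -gf.
  apply: le_trans (ler_norm _) _; apply: le_trans (gphi _) _.
  by move: phi0 => /= ->; rewrite rabs0.
(* A Lipschitz constant of [f] is a bound for these difference quotients, and the weak hypothesis
   bounds their images under every continuous functional. *)
pose S := [set of_real k (mdist z.1 z.2)^-1 *: (f z.1 - f z.2) | z in @off_diagonal R Om].
have [|M SM] := @uniform_boundedness R k E S.
  move=> g gL gb; have [phi [phic gphi]] := real_part_of_functional gL gb.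
  have [_ [M phiM]] := fw phi phic; exists M => _ [z zoff <-].
  apply: le_trans (gphi _) _; rewrite linearZ /= linearB rabsM rabs_of_real.
  rewrite ger0_norm ?invr_ge0 ?mdist_ge0 // mulrC -rnorm_scalars.
  by apply: phiM; exists z.
exists M => _ [z zoff <-]; have := SM _ (ex_intro2 _ _ z zoff erefl).
by rewrite rnormZ rabs_of_real ger0_norm ?invr_ge0 ?mdist_ge0 // mulrC.
Qed.

End PairTopologies.

(** * Compactness of the balls of scalar Lipschitz functions *)

Section ScalarFunctions.
Context (R : realType) (k : scalar_kind).
Local Notation K := (scalars R k).

Let ultra_limit_real (T : Type) (F : set_system T) (h : T -> R) (c : R) :
  UltraFilter F -> F [set t | `|h t| <= c] ->
  exists a, forall e : R, 0 < e -> F [set t | `|h t - a| < e].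
Proof.
move=> UF Fc; have Fh : F (h @^-1` `[- c, c]%classic).
  by apply: filterS Fc => t /=; rewrite in_itv /= -ler_norml.
have [a [_ cla]] := @segment_compact R (- c) c (h @ F) _ Fh.
exists a => e e0; have [//|nFe] := in_ultra_setVsetC [set t | `|h t - a| < e] UF.
have hF : F (h @^-1` [set r | e <= `|r - a|]).
  by apply: filterS nFe => t /= /negP; rewrite -leNgt.
have [r [/= er]] := cla _ _ hF (nbhsx_ballx (a : R^o) e e0).
by rewrite /ball /= distrC ltNge er.
Qed.

(** For complex scalars the limit is taken in the real and imaginary parts, whose absolute values
    are bounded by the modulus and sum to at least the modulus. *)
Lemma ultra_limit (T : Type) (F : set_system T) (h : T -> K^o) (c : R) :
  UltraFilter F -> F [set t | rnorm (h t) <= c] ->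
  exists a : K^o, forall e : R, 0 < e -> F [set t | rnorm (h t - a) < e].
Proof.
case: k h => h UF Fc; first exact: ultra_limit_real UF Fc.
have rnormE (z : R[i]) : rnorm (z : (scalars R ComplexScalars)^o) =
    Num.sqrt (complex.Re z ^+ 2 + complex.Im z ^+ 2).
  by case: z => u v; transitivity (complex.Re `|(u +i* v)%C|); rewrite // normc_def.
have Re_le (z : R[i]) : `|complex.Re z| <= rnorm (z : (scalars R ComplexScalars)^o).
  by rewrite rnormE -sqrtr_sqr ler_sqrt ?addr_ge0 ?sqr_ge0 // lerDl sqr_ge0.
have Im_le (z : R[i]) : `|complex.Im z| <= rnorm (z : (scalars R ComplexScalars)^o).
  by rewrite rnormE -sqrtr_sqr ler_sqrt ?addr_ge0 ?sqr_ge0 // lerDr sqr_ge0.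
have le_ReIm (z : R[i]) : rnorm (z : (scalars R ComplexScalars)^o) <=
    `|complex.Re z| + `|complex.Im z|.
  rewrite rnormE -[leRHS]ger0_norm ?addr_ge0 // -sqrtr_sqr ler_sqrt ?sqr_ge0 //.
  rewrite sqrrD !real_normK ?num_real // -addrA lerD2l lerDr.
  by rewrite mulrn_wge0 // mulr_ge0.
have [|a aF] := @ultra_limit_real T F (fun t => complex.Re (h t : R[i])) c UF.
  by apply: filterS Fc => t; apply: le_trans; exact: Re_le.
have [|b bF] := @ultra_limit_real T F (fun t => complex.Im (h t : R[i])) c UF.
  by apply: filterS Fc => t; apply: le_trans; exact: Im_le.
exists (a +i* b)%C => e e0; have e2 : 0 < e / 2 by rewrite divr_gt0.
apply: filterS (filterI (aF _ e2) (bF _ e2)) => t [/= ua vb].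
apply: le_lt_trans (le_ReIm _) _; rewrite (splitr e).
by move: ua vb; case: (h t) => u v /= ua vb; rewrite ltrD.
Qed.

Context (Om : metricType R) (o : Om).
Local Notation L := (Lip0 o K^o).
Local Notation n := (lip_norm o K^o).
Local Notation co := (tau_co o K^o).

(** An Arzela-Ascoli argument with ultrafilters. The bound M d(x, o) yields pointwise limits, the
    limit keeps the constant M, and [equi_lipschitz_net] turns convergence on a finite net into
    uniform convergence on a compact set. *)
Lemma lip_ball_compact (M : R) : compact ([set f : L | n f <= M] : set (top co)).
Proof.
rewrite compact_ultra => F UF FM.
have [g0 /= g0M] := filter_ex FM.
have M0 : 0 <= M by apply: le_trans g0M; exact: seminorm_ge0 (seminorm_lip o K^o).
have /choice[h hF] : forall x, exists a : K^o, forall e : R, 0 < e ->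
    F [set g : L | rnorm (g x - a) < e].
  move=> x; apply: (@ultra_limit _ F (fun g : L => g x) (M * mdist x o) UF).
  apply: filterS FM => g /= gM; apply: le_trans (Lip0_le g x) _.
  by rewrite ler_wpM2r ?mdist_ge0.
have h0 : h o = 0.
  apply: rnorm_eq0; apply/eqP; rewrite eq_le rnorm_ge0 andbT leNgt.
  apply/negP => /(hF o)/filter_ex[g /=].
  by rewrite Lip0_base sub0r rnormN ltxx.
have hM x y : rnorm (h x - h y) <= M * mdist x y.
  apply/ler_addgt0Pl => e e0; have e2 : 0 < e / 2 by rewrite divr_gt0.
  have [g [[/= gx gy] gM]] := filter_ex (filterI (filterI (hF x _ e2) (hF y _ e2)) FM).
  apply: le_trans (ler_rnormB _ (g x) _) _; rewrite (rnormB (h x)) (splitr e) -addrA.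
  apply: lerD; first exact: ltW.
  apply: le_trans (ler_rnormB _ (g y) _) _; rewrite [leLHS]addrC.
  apply: lerD; first exact: ltW.
  by apply: le_trans (lip_normP g x y) _; rewrite ler_wpM2r ?mdist_ge0.
have [f fh] := Lip0_intro h0 hM.
have fM : n f <= M by apply: lip_norm_le => // x y; rewrite !fh.
exists f; split => // U /nbhs_tau_co[C cC [e e0 eU]].
have e2 : 0 < e / 2 by rewrite divr_gt0.
have [s sC] := equi_lipschitz_net o K^o (2 * M) cC e0.
have Fs : F [set g : L | forall y, y \in s -> rnorm (g y - f y) < e / 2].
  elim: s {sC} => [|y s IH]; first by apply: filterS filterT => g _ y.
  apply: filterS (filterI (hF y _ e2) IH) => g [/= gy gs] z.
  by rewrite inE => /orP[/eqP ->|/gs //]; rewrite fh.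
rewrite nbhs_filterE; apply: filterS (filterI FM Fs) => g [/= gM gs]; apply: eU => x Cx.
rewrite -Lip0B; apply: sC Cx => [|y ys]; last by rewrite Lip0B; exact: gs.
apply: le_trans (seminormD _ _ (seminorm_lip o K^o)) _.
by rewrite (seminormN _ (seminorm_lip o K^o)) mulr_natl mulr2n lerD.
Qed.

End ScalarFunctions.

Theorem corollary4p11 (R : realType) (k : scalar_kind) (Om : metricType R)
    (o : Om) (E : normedModType (scalars R k)) :
  [/\ [/\ saks_space (lip_norm o E) (tau_co o E),
          forall B : set (Lip0 o E), norm_bounded (lip_norm o E) B ->
            coincide_on B (tau_co o E) (tau_fam o E (compact_pairs Om)),
          opens (mixed_topology (lip_norm o E) (tau_co o E)) =
          opens (mixed_topology (lip_norm o E)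
                   (tau_fam o E (compact_pairs Om)))
        & lip0 o E = lip0_weak o E],
      banach E -> saks_complete (lip_norm o E) (tau_co o E),
      hemicompact Om -> saks_C_sequential (lip_norm o E) (tau_co o E)
    & let K := (scalars R k)^o in
      saks_semi_montel (lip_norm o K) (tau_co o K) /\
      forall SS : set (set (Om * Om)),
        SS = finite_pairs Om \/ SS = compact_pairs Om ->
        saks_space (lip_norm o K) (tau_fam o K SS) /\
        forall G : set (Lip0 o K -> R),
          saks_system (lip_norm o K) (tau_fam o K SS) G ->
          opens (mixed_topology (lip_norm o K) (tau_co o K)) =
          opens (submixed_topology G)].
Proof.
have fc := @finite_compact_pairs R Om.
split.
- split; [exact: saks_space_co| | |exact: lip0_weakE].
    by move=> B; exact: coincide_co_fam.
  exact: mixed_co_fam.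
- exact: saks_complete_co.
- exact: C_sequential_co.
move=> K; split.
  apply: mixed_semi_montel; [exact: is_norm_lip|exact: by_seminorms_co|
    exact: co_coarser_norm|exact: lip_ball_compact|exact: norming_co].
move=> SS SSe.
have SSc : SS `<=` compact_pairs Om by case: SSe => ->.
have SSf : finite_pairs Om `<=` SS by case: SSe => ->.
split; first exact: saks_space_fam.
(* [G] is a system for the slope topology, so the mixed topology is first rewritten over it;
   compactness of the balls passes from compact convergence to this coarser topology. *)
move=> G Gsaks; rewrite (mixed_co_fam _ _ SSc SSf).
apply: mixed_submixed => //; [exact: is_norm_lip|exact: by_seminorms_fam|
  exact: fam_coarser_norm|].
move=> M; apply: compact_coarser (@lip_ball_compact _ _ _ _ M).
exact: fam_coarser_co.
Qed.
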